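(* Let $\mathcal{H}=\bigoplus_{n\ge0}\mathcal{H}_n$ be a graded connected Hopf algebra with a fixed state space basis $\mathcal{B}=\coprod_n\mathcal{B}_n$, and fix $n$. Then all $\Psi$-Markov chains on $\mathcal{B}_n$ (for $\Psi$ ranging over non-negative convolutions of projections on $\mathcal{H}_n$) have the same set of stationary distributions. These stationary distributions can be uniquely written as a linear combination of the functions \[\pi_{c_1,\dots,c_n}(x):=\frac{\eta(x)}{(n!)^2}\sum_{\sigma\in\mathfrak{S}_n}\bigl(\text{coefficient of }x\text{ in the product }c_{\sigma(1)}\cdots c_{\sigma(n)}\bigr),\qquad x\in\mathcal{B}_n,\] one for each multiset $\{c_1,\dots,c_n\}$ of elements of $\mathcal{B}_1$.
   Context: The ground field is $\mathbb{Q}$ or $\mathbb{R}$. A graded Hopf algebra $\mathcal{H}=\bigoplus_{n\ge0}\mathcal{H}_n$ is connected if $\dim\mathcal{H}_0=1$; each $\mathcal{H}_n$ is finite-dimensional. A basis $\mathcal{B}=\coprod_n\mathcal{B}_n$ ($\mathcal{B}_n$ a basis of $\mathcal{H}_n$) is a state space basis if: (i) for all $w,z\in\mathcal{B}$, $m(w\otimes z)$ has non-negative coefficients in $\mathcal{B}$; (ii) for all $x\in\mathcal{B}$, $\Delta(x)$ has non-negative coefficients in $\mathcal{B}\otimes\mathcal{B}$; (iii) for $n>1$, no $x\in\mathcal{B}_n$ is primitive, i.e. $\Delta(x)\ne1\otimes x+x\otimes1$. For linear maps $f,g:\mathcal{H}\to\mathcal{H}$, the convolution is $f*g:=m(f\otimes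 g)\Delta$. $\mathrm{Proj}_d$ is the projection onto $\mathcal{H}_d$ (identity on $\mathcal{H}_d$, zero on $\mathcal{H}_i$, $i\ne d$; $d=0$ allowed). Iterated coproduct: $\Delta^{[1]}=\iota$ (identity), $\Delta^{[a]}=(\iota\otimes\dots\otimes\iota\otimes\Delta)\Delta^{[a-1]}$. Fix $a\ge2$. A non-negative convolution of projections on $\mathcal{H}_n$ is $\Psi=\sum_D\alpha_D\,\mathrm{Proj}_{d_1}*\dots*\mathrm{Proj}_{d_a}$, sum over weak compositions $D=(d_1,\dots,d_a)$ ($d_i\ge0$), with $\alpha_D\ge0$ for all weak compositions $D$ of $n$ and $\alpha_D>0$ for some weak composition $D$ of $n$ with every $d_i\ne n$. For $x\in\mathcal{B}_n$, $\eta(x)$ is the sum of the coefficients, in the basis $\mathcal{B}^{\otimes n}$, of $\mathrm{Proj}_1^{\otimes n}\Delta^{[n]}(x)$. Let $\beta_n:=\sum_{d_1+\dots+d_a=n}\alpha_D\binom{n}{d_1\,\dots\,d_a}$. The $\Psi$-Markov chain on $\mathcal{B}_n$ has state space $\mathcal{B}_n$ and transition probabilities $K(x,y)=\frac{\eta(y)}{\eta(x)\beta_n}\cdot[\text{coefficient of }y\text{ in }\Psi(x)]$ (the transpose of the matrix of $\frac1{\beta_n}\Psi$ in the basis $\{x/\eta(x)\}$). *)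

(* Defs.v *)
From HB Require Import structures.
From mathcomp Require Import all_boot all_order perm all_algebra.
From mathcomp Require Import boolp classical_sets fsbigop reals.

Set Implicit Arguments.
Unset Strict Implicit.
Unset Printing Implicit Defensive.

Import Order.TTheory GRing.Theory Num.Theory.
Local Open Scope quotient_scope.
Local Open Scope classical_set_scope.
Local Open Scope ring_scope.

(** * Tensor products of modules *)

Section Tensor.
Variables (k : comNzRingType) (U V : lmodType k).

Definition bilinear_map (W : lmodType k) (f : U -> V -> W) : Prop :=
  (forall v, linear (f^~ v)) /\ (forall u, linear (f u)).

(* Value of a map of two variables on the formal sum of pairs [s]. *)
Definition formal_eval (W : lmodType k) (f : U -> V -> W) (s : seq (U * V)) : W :=
  \sum_(p <- s) f p.1 p.2.

(* The tensor product is the set of formal sums of pairs (u, v) modulo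
   indistinguishability by bilinear maps. Its universal property is given by
   [tensor_eqP], [pure_bilinear], [tlift_linear], [tlift_pure] and
   [tensor_pureE] below. *)
Definition tensor_equiv (s t : seq (U * V)) : bool :=
  `[< forall (W : lmodType k) (f : U -> V -> W), bilinear_map f ->
        formal_eval f s = formal_eval f t >].

Lemma tensor_equiv_refl : reflexive tensor_equiv.
Proof. by move=> s; apply/asboolP. Qed.

Lemma tensor_equiv_sym : symmetric tensor_equiv.
Proof.
by move=> s t; apply/asboolP/asboolP => h W f fb; rewrite (h W f fb).
Qed.

Lemma tensor_equiv_trans : transitive tensor_equiv.
Proof.
move=> t s r /asboolP h1 /asboolP h2; apply/asboolP => W f fb.
by rewrite (h1 W f fb) (h2 W f fb).
Qed.

Canonical tensor_equiv_rel : equiv_rel (seq (U * V)) :=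
  EquivRel tensor_equiv tensor_equiv_refl tensor_equiv_sym tensor_equiv_trans.

Definition tensor := {eq_quot tensor_equiv_rel}.
HB.instance Definition _ := Choice.on tensor.
HB.instance Definition _ := EqQuotient.on tensor.

Definition pure (u : U) (v : V) : tensor := \pi_tensor [:: (u, v)].

(* For bilinear [f], the linear map on [tensor] with [pure u v |-> f u v]. *)
Definition tlift (W : lmodType k) (f : U -> V -> W) (t : tensor) : W :=
  formal_eval f (repr t).

Lemma tensor_eqP (s t : tensor) :
  (forall (W : lmodType k) (f : U -> V -> W), bilinear_map f ->
    tlift f s = tlift f t) -> s = t.
Proof.
by move=> h; rewrite -[s]reprK -[t]reprK; apply/eqmodP/asboolP => W f /h.
Qed.

Lemma tlift_pi (W : lmodType k) (f : U -> V -> W) (s : seq (U * V)) :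
  bilinear_map f -> tlift f (\pi_tensor s) = formal_eval f s.
Proof.
move=> fb; rewrite /tlift.
have /eqmodP /asboolP := reprK (\pi_tensor s); exact.
Qed.

Definition tensor_zero : tensor := \pi_tensor [::].
Definition tensor_add (s t : tensor) : tensor := \pi_tensor (repr s ++ repr t).
Definition tensor_scale (c : k) (t : tensor) : tensor :=
  \pi_tensor [seq (c *: p.1, p.2) | p <- repr t].
Definition tensor_opp (t : tensor) : tensor := tensor_scale (-1) t.

Section Lift.
Variables (W : lmodType k) (f : U -> V -> W) (fb : bilinear_map f).

Lemma bilinear_scalel c u v : f (c *: u) v = c *: f u v.
Proof.
have f0 : f 0 v = 0.
  have := fb.1 v 1 0 0; rewrite !scale1r addr0 => /eqP.
  by rewrite -subr_eq subrr eq_sym => /eqP.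
by have := fb.1 v c u 0; rewrite f0 !addr0.
Qed.

Lemma tlift0_subproof : tlift f tensor_zero = 0.
Proof. by rewrite tlift_pi // /formal_eval big_nil. Qed.

Lemma tliftD_subproof s t : tlift f (tensor_add s t) = tlift f s + tlift f t.
Proof. by rewrite tlift_pi // /formal_eval big_cat. Qed.

Lemma tliftZ_subproof c t : tlift f (tensor_scale c t) = c *: tlift f t.
Proof.
rewrite tlift_pi // /tlift /formal_eval big_map scaler_sumr.
by apply: eq_bigr => p _; rewrite bilinear_scalel.
Qed.

End Lift.

Lemma tensor_addA : associative tensor_add.
Proof.
by move=> s t r; apply: tensor_eqP => W f fb; rewrite !tliftD_subproof // addrA.
Qed.

Lemma tensor_addC : commutative tensor_add.
Proof.
by move=> s t; apply: tensor_eqP => W f fb; rewrite !tliftD_subproof // addrC.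
Qed.

Lemma tensor_add0 : left_id tensor_zero tensor_add.
Proof.
move=> t; apply: tensor_eqP => W f fb.
by rewrite tliftD_subproof // tlift0_subproof // add0r.
Qed.

Lemma tensor_addN : left_inverse tensor_zero tensor_opp tensor_add.
Proof.
move=> t; apply: tensor_eqP => W f fb.
by rewrite tliftD_subproof // tliftZ_subproof // tlift0_subproof // scaleN1r addNr.
Qed.

HB.instance Definition _ :=
  GRing.isZmodule.Build tensor tensor_addA tensor_addC tensor_add0 tensor_addN.

Lemma tensor_scaleA a b t :
  tensor_scale a (tensor_scale b t) = tensor_scale (a * b) t.
Proof.
by apply: tensor_eqP => W f fb; rewrite !tliftZ_subproof // scalerA.
Qed.

Lemma tensor_scale1 : left_id 1 tensor_scale.
Proof.
by move=> t; apply: tensor_eqP => W f fb; rewrite tliftZ_subproof // scale1r.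
Qed.

Lemma tensor_scaleDr : right_distributive tensor_scale +%R.
Proof.
move=> c s t; apply: tensor_eqP => W f fb.
by rewrite tliftZ_subproof // !tliftD_subproof // !tliftZ_subproof // scalerDr.
Qed.

Lemma tensor_scaleDl t : {morph tensor_scale^~ t : a b / a + b}.
Proof.
move=> a b; apply: tensor_eqP => W f fb.
by rewrite tliftD_subproof // !tliftZ_subproof // scalerDl.
Qed.

HB.instance Definition _ :=
  GRing.Zmodule_isLmodule.Build k tensor
    tensor_scaleA tensor_scale1 tensor_scaleDr tensor_scaleDl.

Lemma tlift_linear (W : lmodType k) (f : U -> V -> W) :
  bilinear_map f -> linear (tlift f).
Proof.
by move=> fb c s t; rewrite tliftD_subproof // tliftZ_subproof.
Qed.

Lemma tlift_pure (W : lmodType k) (f : U -> V -> W) (u : U) (v : V) :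
  bilinear_map f -> tlift f (pure u v) = f u v.
Proof. by move=> fb; rewrite tlift_pi // /formal_eval big_seq1. Qed.

Lemma pure_bilinear : bilinear_map pure.
Proof.
split=> [v c u u'|u c v v']; apply: tensor_eqP => W f fb;
  rewrite (tlift_linear fb) /= !(tlift_pure _ _ fb).
- exact: fb.1.
- exact: fb.2.
Qed.

Lemma tensor_pureE (t : tensor) : t = \sum_(p <- repr t) pure p.1 p.2.
Proof.
rewrite -{1}[t]reprK; elim: (repr t) => [|p s IHs].
  by rewrite big_nil; apply: tensor_eqP => W f fb.
rewrite big_cons -IHs; apply: tensor_eqP => W f fb.
rewrite (tliftD_subproof fb) (tlift_pure _ _ fb) !(tlift_pi _ fb).
by rewrite /formal_eval big_cons.
Qed.

End Tensor.

Notation "u ⊗ v" := (pure u v) (at level 40, left associativity) : ring_scope.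

Section TensorMaps.
Variable k : comNzRingType.

(* The map f ⊗ g. *)
Definition tmap (U U' V V' : lmodType k) (f : U -> U') (g : V -> V') :
    tensor U V -> tensor U' V' :=
  tlift (fun u v => f u ⊗ g v).

Definition tassoc (U V W : lmodType k) :
    tensor (tensor U V) W -> tensor U (tensor V W) :=
  tlift (fun t w => tlift (fun u v => u ⊗ (v ⊗ w)) t).

(* The multiplication map m : A ⊗ A -> A. *)
Definition tmult (A : algType k) : tensor A A -> A := tlift (fun u v => u * v).

(* The product of A ⊗ A: (u ⊗ v)(u' ⊗ v') = uu' ⊗ vv'. *)
Definition tensor_mul (A : algType k) (s t : tensor A A) : tensor A A :=
  tlift (fun u v => tlift (fun u' v' => (u * u') ⊗ (v * v')) t) s.

(* [tpow U a] is the (a+1)-fold tensor power of U, bracketed to the right. *)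
Fixpoint tpow (U : lmodType k) (a : nat) : lmodType k :=
  if a is a'.+1 then (tensor U (tpow U a') : lmodType k) else U.

(* f ⊗ ... ⊗ f *)
Fixpoint tpow_map (U : lmodType k) (f : U -> U) (a : nat) :
    tpow U a -> tpow U a :=
  if a is a'.+1 then tmap f (tpow_map f (a := a')) else f.

End TensorMaps.

(** * Graded connected Hopf algebras *)

Record graded_hopf (k : fieldType) := GradedHopf {
  carrier :> algType k;
  Delta : {linear carrier -> tensor carrier carrier};
  counit : {linear carrier -> k^o};
  antipode : {linear carrier -> carrier};
  (* The grading is given by its projections: the component of degree n is the
     subspace of fixed points of [Proj n]. *)
  Proj : nat -> {linear carrier -> carrier};

  coassoc : forall x,
    tassoc (tmap Delta idfun (Delta x)) = tmap idfun Delta (Delta x);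
  counitl : forall x, tlift (fun u v => counit u *: v) (Delta x) = x;
  counitr : forall x, tlift (fun u v => counit v *: u) (Delta x) = x;
  Delta1 : Delta 1 = 1 ⊗ 1;
  DeltaM : forall x y, Delta (x * y) = tensor_mul (Delta x) (Delta y);
  counit1 : counit 1 = 1;
  counitM : forall x y, counit (x * y) = counit x * counit y;
  antipodel : forall x,
    tmult (tmap antipode idfun (Delta x)) = counit x *: 1;
  antipoder : forall x,
    tmult (tmap idfun antipode (Delta x)) = counit x *: 1;

  ProjK : forall i j x, Proj i (Proj j x) = if i == j then Proj j x else 0;
  Proj_sum : forall x, exists N, x = \sum_(i < N) Proj i x;
  graded1 : Proj 0%N 1 = 1;
  gradedM : forall i j x y, Proj i x = x -> Proj j y = y ->
    Proj (i + j)%N (x * y) = x * y;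
  graded_counit : forall n x, Proj n x = x -> n != 0%N -> counit x = 0;
  (* Δ(H_n) is contained in the sum of the H_i ⊗ H_j with i + j = n. *)
  graded_Delta : forall n x, Proj n x = x ->
    exists s : seq (carrier * carrier),
      Delta x = \sum_(p <- s) p.1 ⊗ p.2 /\
      forall p, p \in s -> exists i j, [/\ (i + j)%N = n,
        Proj i p.1 = p.1 & Proj j p.2 = p.2]
}.

Arguments Delta {k g}.
Arguments counit {k g}.
Arguments antipode {k g}.
Arguments Proj {k} g n.

Section Hopf.
Variables (k : fieldType) (H : graded_hopf k).

Definition homog (n : nat) (x : H) : Prop := Proj H n x = x.

(* dim H_0 = 1 *)
Definition connected : Prop :=
  exists e : H, [/\ homog 0%N e, e != 0 &
    forall x, homog 0%N x -> exists c : k, x = c *: e].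

(* The convolution product of endomorphisms. *)
Definition conv (f g : H -> H) : H -> H :=
  fun x => tmult (tmap f g (Delta x)).

Definition conv_seq (fs : seq (H -> H)) : H -> H :=
  if fs is f :: fs' then foldl conv f fs' else fun x => counit x *: 1.

(* ι ⊗ ... ⊗ ι ⊗ Δ on the (a+1)-fold tensor power. *)
Fixpoint Delta_last (a : nat) : tpow H a -> tpow H a.+1 :=
  if a is a'.+1 then tmap idfun (@Delta_last a') else Delta.

(* [iter_Delta a] is the iterated coproduct with values in the (a+1)-fold
   tensor power, written Δ^[a+1]. *)
Fixpoint iter_Delta (a : nat) : H -> tpow H a :=
  if a is a'.+1 then fun x => Delta_last (iter_Delta a' x) else idfun.

(* A basis B = ∐ B_n, where B_n = basis_index n labels a basis of H_n, given
   with its coordinate functions. In particular each H_n is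
   finite-dimensional. *)
Record graded_basis := GradedBasis {
  basis_index :> nat -> finType;
  bvec : forall n, basis_index n -> H;
  coord : forall n, basis_index n -> {linear H -> k^o};
  bvec_homog : forall n (x : basis_index n), homog n (bvec x);
  coord_bvec : forall m n (y : basis_index m) (x : basis_index n),
    coord y (bvec x) =
    (Tagged basis_index y == Tagged basis_index x :> {i : nat & basis_index i})%:R;
  bvec_span : forall n (v : H), homog n v ->
    v = \sum_(x : basis_index n) coord x v *: bvec x
}.

End Hopf.

Section StateSpace.
Variables (k : realFieldType) (H : graded_hopf k) (B : graded_basis H).

(* The index set of the whole basis B. *)
Definition total_index := {n : nat & B n}.

Definition tvec (w : total_index) : H := bvec (tagged w).
Definition tcoord (w : total_index) : {linear H -> k^o} := coord (tagged w).

(* Coefficient of w ⊗ z in an element of H ⊗ H. *)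
Definition coord2 (w z : total_index) : tensor H H -> k^o :=
  tlift (fun u v => tcoord w u * tcoord z v : k^o).

(* Coefficient of w_0 ⊗ ... ⊗ w_a in an element of the (a+1)-fold tensor power;
   only used for lists of length a+1. *)
Fixpoint tpow_coord (a : nat) (ws : seq total_index) : tpow H a -> k^o :=
  match a, ws with
  | 0, w :: _ => fun t => tcoord w t
  | a'.+1, w :: ws' =>
      tlift (fun u t => tcoord w u * tpow_coord ws' (a := a') t : k^o)
  | _, [::] => fun=> 0
  end.

Definition state_space_basis : Prop :=
  [/\ forall w z x : total_index, 0 <= tcoord x (tvec w * tvec z),
      forall x w z : total_index, 0 <= coord2 w z (Delta (tvec x)) &
      forall n (x : B n), (1 < n)%N ->
        Delta (bvec x) <> 1 ⊗ bvec x + bvec x ⊗ 1].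

(* The sum of all the coefficients of Proj_1^{⊗n} Δ^[n](x) in the basis
   B^{⊗n}; the sum has finite support. The value at n = 0, where Δ^[n] is not
   defined, is not significant. *)
Definition eta (n : nat) (x : B n) : k :=
  \sum_(ws \in [set: n.-tuple total_index])
    tpow_coord ws (tpow_map (Proj H 1%N) (iter_Delta n.-1 (bvec x))).

Section Chain.
Variables (a n : nat) (alpha : a.-tuple 'I_n.+1 -> k).

(* The parts of a weak composition of n are at most n. *)
Definition weak_composition (D : a.-tuple 'I_n.+1) : bool :=
  (\sum_(i < a) tnth D i == n)%N.

(* Σ_D α_D Proj_{d_1} * ... * Proj_{d_a} *)
Definition Psi (v : H) : H :=
  \sum_(D | weak_composition D)
    alpha D *: conv_seq [seq (Proj H d : H -> H) | d : 'I_n.+1 <- D] v.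

Definition nonneg_convolution : Prop :=
  [/\ (2 <= a)%N,
      forall D, weak_composition D -> 0 <= alpha D &
      exists D, [/\ weak_composition D, 0 < alpha D &
        forall i, tnth D i != n :> nat]].

Definition beta : k :=
  \sum_(D | weak_composition D)
    alpha D * (n`!%:R / \prod_(i < a) (tnth D i)`!%:R).

Definition transition (x y : B n) : k :=
  eta y / (eta x * beta) * coord y (Psi (bvec x)).

End Chain.

Definition pi_fun (n : nat) (c : n.-tuple (B 1%N)) (x : B n) : k :=
  eta x / n`!%:R ^+ 2 *
  \sum_(s : 'S_n) coord x (\prod_(i < n) bvec (tnth c (s i))).

End StateSpace.

(** * Stationary distributions and multisets *)

Definition stationary_distribution (R : realType) (T : finType)
    (K : T -> T -> R) (p : T -> R) : Prop :=
  [/\ forall x, 0 <= p x, \sum_x p x = 1 &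
      forall y, \sum_x p x * K x y = p y].

(* Multisets of size n in T, each represented by its unique listing which is
   nondecreasing along the enumeration of T. *)
Definition multiset (n : nat) (T : finType) :=
  {c : n.-tuple T | sorted (fun x y => (enum_rank x <= enum_rank y)%N) c}.

(* Main.v *)
From HB Require Import structures.
Require Import Defs.
From mathcomp Require Import all_boot all_order perm all_algebra.
From mathcomp Require Import boolp classical_sets fsbigop reals.
From mathcomp Require Import zify ring.

(* Since eta > 0, dividing a stationary distribution by eta turns it into a left
   eigenvector of Psi on H_n for the eigenvalue beta. Symmetrised products of
   degree one (hence primitive) elements are such eigenvectors, because Psi deals
   the letters of a product into piles and beta counts the ways of dealing; they
   are independent by computing coefficients of their iterated coproducts.

   That there are no others is proved on the dual side: let f be a functional on
   H_n with f o Psi = beta f that vanishes on the symmetrised products. By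
   descending induction on r, f kills all products of r homogeneous elements of
   positive degree. Modulo longer products the factors behave as primitive
   elements, so f becomes a function of the order of the factors, harmonic for
   dealing. If some factor has degree at least 2, fewer than beta dealings respect
   the factors and the function is 0 by contraction. If r = n, the words where it
   is maximal and those where it is minimal are closed under dealing, and dealing
   two words in the same way enough times makes them equal; so the function is
   constant, and its sum over all orders vanishes.

   Positivity of eta: as no basis element of degree at least 2 is primitive,
   coassociativity and non-negativity give it a nonzero component in
   H_1 (x) H_(n-1). *)

Set Implicit Arguments.
Unset Strict Implicit.
Unset Printing Implicit Defensive.

Import Order.TTheory GRing.Theory Num.Theory.
Local Open Scope ring_scope.

(** * Unshuffling and dealing words *)

Section Words.
Local Open Scope nat_scope.

(** Lists, with multiplicity, the splittings of a word into a subword and its complement; they index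
    the coproduct of a product of primitive elements. *)
Fixpoint unshuffle (T : Type) (w : seq T) : seq (seq T * seq T) :=
  if w is i :: w' then [seq (i :: p.1, p.2) | p <- unshuffle w'] ++
                       [seq (p.1, i :: p.2) | p <- unshuffle w']
  else [:: ([::], [::])].

Definition weight (T : Type) (e : T -> nat) (w : seq T) : nat :=
  \sum_(i <- w) e i.

(* The words obtained by dealing [w] into piles of prescribed weights and
   concatenating the piles; [D] lists the weights from the last pile to the
   first. *)
Fixpoint deal (T : Type) (e : T -> nat) (D : seq nat) (w : seq T) :
    seq (seq T) :=
  if D is d :: D' then
    flatten [seq [seq u ++ p.2 | u <- deal e D' p.1]
            | p <- unshuffle w & weight e p.2 == d]
  else if w is [::] then [:: [::]] else [::].

Lemma weight_cons (T : Type) (e : T -> nat) i w :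
  weight e (i :: w) = e i + weight e w.
Proof. exact: big_cons. Qed.

Lemma weight_cat (T : Type) (e : T -> nat) u v :
  weight e (u ++ v) = weight e u + weight e v.
Proof. exact: big_cat. Qed.

Lemma weight_map (S T : Type) (h : S -> T) (e : T -> nat) w :
  weight e (map h w) = weight (e \o h) w.
Proof. exact: big_map. Qed.

Lemma weight_size (T : Type) (e : T -> nat) w :
  all (fun i => e i == 1) w -> weight e w = size w.
Proof.
elim: w => [|i w IHw]; first by rewrite /weight big_nil.
by rewrite /= weight_cons => /andP[/eqP -> /IHw ->].
Qed.

Lemma size_le_weight (T : Type) (e : T -> nat) w :
  all (fun i => 0 < e i) w -> size w <= weight e w.
Proof.
elim: w => [//|i w IHw] /=; rewrite weight_cons => /andP[e0 /IHw]; lia.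
Qed.

Lemma size_lt_weight (T : Type) (e : T -> nat) w :
  all (fun i => 0 < e i) w -> has (fun i => 1 < e i) w -> size w < weight e w.
Proof.
elim: w => [//|i w IHw] /=; rewrite weight_cons => /andP[e0 ew].
have ws := size_le_weight ew.
by case/orP => [|/(IHw ew)]; lia.
Qed.

Lemma sum_deal (T : Type) (e : T -> nat) d D w (R : nmodType)
    (F : seq T -> R) :
  (\sum_(u <- deal e (d :: D) w) F u =
   \sum_(p <- unshuffle w | weight e p.2 == d)
     \sum_(u <- deal e D p.1) F (u ++ p.2))%R.
Proof.
rewrite /= big_flatten big_map big_filter.
by apply: eq_bigr => p _; rewrite big_map.
Qed.

Lemma unshuffle_map (S T : Type) (h : S -> T) w :
  unshuffle (map h w) = [seq (map h p.1, map h p.2) | p <- unshuffle w].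
Proof.
by elim: w => [//|i w IHw] /=; rewrite IHw map_cat -!map_comp.
Qed.

Lemma deal_map (S T : Type) (h : S -> T) (e : T -> nat) D w :
  deal e D (map h w) = map (map h) (deal (e \o h) D w).
Proof.
elim: D w => [|d D IHD] w /=; first by case: w.
rewrite unshuffle_map filter_map -map_comp map_flatten -map_comp.
have eP : preim (fun p : seq S * seq S => (map h p.1, map h p.2))
    (fun p => weight e p.2 == d) =1 (fun p => weight (e \o h) p.2 == d).
  by move=> p; rewrite /= weight_map.
rewrite (eq_filter eP); congr flatten; apply: eq_map => p /=.
by rewrite IHD -!map_comp; apply: eq_map => u /=; rewrite map_cat.
Qed.

Section EqWords.
Variable T : eqType.
Implicit Types (w : seq T) (e : T -> nat) (p : seq T * seq T).

Lemma unshuffle_perm w p : p \in unshuffle w -> perm_eq (p.1 ++ p.2) w.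
Proof.
elim: w p => [|i w IHw] p /=; first by rewrite inE => /eqP ->.
rewrite mem_cat => /orP[] /mapP[q /IHw qw ->] /=; first by rewrite perm_cons.
by rewrite -cat1s perm_catCA /= perm_cons.
Qed.

Lemma deal_perm e D w u : u \in deal e D w -> perm_eq u w.
Proof.
elim: D w u => [|d D IHD] w u /=; first by case: w => //; rewrite inE => /eqP ->.
case/flattenP => s /mapP[p]; rewrite mem_filter => /andP[_ /unshuffle_perm pw].
move=> -> /mapP[v /IHD vp ->]; apply: perm_trans pw.
by rewrite perm_cat2r.
Qed.

Lemma unshuffle_filter (A : pred T) w :
  (filter (predC A) w, filter A w) \in unshuffle w.
Proof.
elim: w => [|i w IHw] //=.
rewrite mem_cat; case: (A i) => /=; apply/orP.
  right; exact: (map_f (fun p => (p.1, i :: p.2)) IHw).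
left; exact: (map_f (fun p => (i :: p.1, p.2)) IHw).
Qed.

Lemma unshuffle_nilr w : (w, [::]) \in unshuffle w.
Proof.
elim: w => [|i w IHw] //=; rewrite mem_cat; apply/orP; left.
exact: (map_f (fun p => (i :: p.1, p.2)) IHw).
Qed.

Lemma unshuffle_weight e w p :
  p \in unshuffle w -> weight e p.1 + weight e p.2 = weight e w.
Proof.
by move=> /unshuffle_perm pw; rewrite -weight_cat /weight (perm_big _ pw).
Qed.

Lemma unshuffle_sub w p (a : pred T) :
  p \in unshuffle w -> all a w -> all a p.1 && all a p.2.
Proof. by move=> /unshuffle_perm pw; rewrite -all_cat (perm_all _ pw). Qed.

Lemma mem_deal e d D w p u : p \in unshuffle w -> weight e p.2 = d ->
  u \in deal e D p.1 -> u ++ p.2 \in deal e (d :: D) w.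
Proof.
move=> pw pd up /=; apply/flattenP; exists [seq v ++ p.2 | v <- deal e D p.1].
  by apply/mapP; exists p; rewrite ?mem_filter ?pd ?eqxx.
exact: map_f.
Qed.

(** Cutting [w] into consecutive blocks of the prescribed lengths is one of its dealings. *)
Lemma deal_id e D w : (forall i, e i = 1) -> sumn D = size w ->
  w \in deal e D w.
Proof.
move=> e1; elim: D w => [|d D IHD] w /=; first by case: w.
move=> sD.
suff : take (sumn D) w ++ drop (sumn D) w \in deal e (d :: D) w.
  by rewrite cat_take_drop.
have pw : forall n, (take n w, drop n w) \in unshuffle w.
  elim: w {sD} => [|i w IHw] n //=; rewrite mem_cat.
  case: n => [|n].
    apply/orP; right; move: (IHw 0); rewrite take0 drop0 => pw.
    exact: (map_f (fun p => (p.1, i :: p.2)) pw).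
  apply/orP; left; exact: (map_f (fun p => (i :: p.1, p.2)) (IHw n)).
apply: (mem_deal (pw _)) => /=.
  by rewrite weight_size ?size_drop; [lia|apply/allP => i _; rewrite e1].
by apply: IHD; rewrite size_take; case: ltngtP; lia.
Qed.

(** The first nonzero entry of [D] serves as [d]: its pile may consist of any [d] letters, and by
    [deal_id] the other piles can be dealt so as to leave the rest in order. It is less than the
    whole word because no entry equals [size w]. *)
Lemma deal_filter e D w : (forall i, e i = 1) -> sumn D = size w ->
    all (fun d => d != size w) D -> 0 < size w ->
  exists2 d, 0 < d < size w & forall (A : pred T) w', size w' = size w ->
    count A w' = d -> filter (predC A) w' ++ filter A w' \in deal e D w'.
Proof.
move=> e1; elim: D => [|d D IHD] /=; first by case: w.
move=> sD /andP[dw Dw] w0; have [d0|d0] := posnP d.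
  have [|d' d'w IH] := IHD _ Dw w0; first by lia.
  exists d' => // A w' sw' /(IH A w' sw') Aw'.
  rewrite -[X in X \in _]cats0; apply: (mem_deal (unshuffle_nilr w')) => //=.
  by rewrite d0 /weight big_nil.
exists d => [|A w' sw' Ad]; first by lia.
apply: (mem_deal (unshuffle_filter A w')) => /=.
  rewrite weight_size; last by apply/allP => i _; rewrite e1.
  by rewrite size_filter.
apply: deal_id => //; rewrite size_filter.
by have := count_predC A w'; lia.
Qed.

End EqWords.

(** * Counting unshuffles and dealings against multinomial coefficients *)

Section Counting.
Variables (T : eqType) (e : T -> nat).
Implicit Type w : seq T.

Definition unshuffles w d :=
  count (fun p : seq T * seq T => weight e p.2 == d) (unshuffle w).

Lemma unshuffles_nil d : unshuffles [::] d = (d == 0).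
Proof. by rewrite /unshuffles /= /weight big_nil eq_sym addn0. Qed.

Lemma unshuffles_cons i w d : unshuffles (i :: w) d =
  unshuffles w d + (if e i <= d then unshuffles w (d - e i) else 0).
Proof.
rewrite /unshuffles /= count_cat !count_map; congr (_ + _).
have [id|id] := leqP (e i) d.
  by apply: eq_count => p /=; rewrite weight_cons; lia.
rewrite (@eq_count _ _ pred0) ?count_pred0 // => p /=.
by rewrite weight_cons; lia.
Qed.

(** The left side consists of the two extreme terms of Vandermonde's sum: none or all of the [c]
    added points are chosen. *)
Lemma bin_add_ge m c d : 0 < c ->
  'C(m, d) + (if c <= d then 'C(m, d - c) else 0) <= 'C(m + c, d).
Proof.
case: c => // c _; rewrite addnC [m + _]addnC -(binomial.Vandermonde c.+1 m d).
rewrite big_ord_recl /= bin0 mul1n subn0 addnC leq_add2l.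
case: ifP => // cd; case: d cd => // d cd.
rewrite (bigD1 (Ordinal (cd : c < d.+1))) //= /bump /= add1n binn mul1n.
exact: leq_addr.
Qed.

Lemma bin_add_gt m c d : 1 < c -> 0 < d < m + c ->
  'C(m, d) + (if c <= d then 'C(m, d - c) else 0) < 'C(m + c, d).
Proof.
case: c => [|[|c]] // _; case: d => // d /= dmc.
rewrite addnC [m + _]addnC -(binomial.Vandermonde c.+2 m d.+1).
rewrite big_ord_recl /= bin0 mul1n subn0 addnC -addnS leq_add2l.
(* One more than this index is the least positive number of added points that leaves at most [m]
   others to choose. It stays below the number of added points, so its positive term is neither of
   the two extreme ones. *)
have jd : maxn 0 (d - m) < d.+1 by lia.
rewrite (bigD1 (Ordinal jd)) //= /bump /= add1n.
set t := _ * _; have t0 : 0 < t by rewrite muln_gt0 !bin_gt0; lia.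
rewrite -add1n; apply: leq_add => //.
case: ifP => // cd.
have cd' : c.+1 < d.+1 by [].
rewrite (bigD1 (Ordinal cd')) /=; last by rewrite -val_eqE /=; lia.
by rewrite /bump /= add1n binn mul1n leq_addr.
Qed.

Lemma unshuffles_eq w d : all (fun i => e i == 1) w ->
  unshuffles w d = 'C(size w, d).
Proof.
elim: w d => [|i w IHw] d /=; first by rewrite unshuffles_nil bin0n eq_sym.
case/andP=> /eqP ei ew; rewrite unshuffles_cons ei IHw //.
by case: d => [|d] /=; rewrite ?bin0 // IHw // subn1 binS.
Qed.

(** A letter of weight [c] acts as a block of [c] points: subwords of weight [d] are then those sets
    of [d] points that are unions of blocks. *)
Lemma unshuffles_le w d : all (fun i => 0 < e i) w ->
  unshuffles w d <= 'C(weight e w, d).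
Proof.
elim: w d => [|i w IHw] d /=.
  by rewrite unshuffles_nil /weight big_nil bin0n eq_sym.
case/andP=> ei ew; rewrite unshuffles_cons weight_cons addnC addnC [e i + _]addnC.
apply: leq_trans (bin_add_ge _ _ ei); rewrite leq_add ?IHw //.
by case: ifP => // _; exact: IHw.
Qed.

Lemma unshuffles_lt w d : all (fun i => 0 < e i) w ->
  has (fun i => 1 < e i) w -> 0 < d < weight e w ->
  unshuffles w d < 'C(weight e w, d).
Proof.
elim: w d => [//|i w IHw] d /=.
case/andP=> ei ew; rewrite unshuffles_cons weight_cons [e i + _]addnC => ew2 dw.
have le1 := unshuffles_le d ew; have le2 := unshuffles_le (d - e i) ew.
have [ei1|ei1] := ltnP 1 (e i).
  apply: leq_ltn_trans (bin_add_gt ei1 dw); rewrite leq_add //.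
  by case: ifP.
have {ew2} ew2 : has (fun i => 1 < e i) w by move: ew2; rewrite ltnNge ei1.
apply: leq_trans (bin_add_ge _ _ ei).
have mw : 1 < weight e w.
  have := size_lt_weight ew ew2; move: ew2; rewrite has_count.
  by have := count_size (fun i => 1 < e i) w; lia.
(* Here [e i] is 1, so [d] is at most the weight of [w]. Induction makes the first summand strict if
   [d] is smaller and the second one if [d] is equal. *)
have [dm|dm] := ltnP d (weight e w).
  have := IHw d ew ew2; case: ifP => _; lia.
have := IHw (d - e i) ew ew2; case: ifP => ?; lia.
Qed.

Lemma size_deal_cons d D w : size (deal e (d :: D) w) =
  \sum_(p <- unshuffle w | weight e p.2 == d) size (deal e D p.1).
Proof.
rewrite /= size_flatten /shape -map_comp sumnE big_map big_filter.
by apply: eq_bigr => p _; rewrite /= size_map.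
Qed.

Lemma sum_unshuffle_const w d c :
  \sum_(p <- unshuffle w | weight e p.2 == d) c = unshuffles w d * c.
Proof. by rewrite big_const_seq iter_addn_0 mulnC. Qed.

Lemma bin_mul_fact n d : 'C(n, d) * ((n - d)`! * d`!) <= n`!.
Proof.
have [dn|dn] := leqP d n; last by rewrite bin_small.
by rewrite -(bin_fact dn) [d`! * _]mulnC.
Qed.

Lemma size_deal_le D w : all (fun i => 0 < e i) w ->
  size (deal e D w) * \prod_(d <- D) d`! <= (weight e w)`!.
Proof.
elim: D w => [|d D IHD] w ew.
  by rewrite big_nil muln1 /=; case: w ew => //= *; rewrite fact_gt0.
rewrite size_deal_cons big_cons big_distrl /=.
apply: leq_trans (bin_mul_fact _ d).
apply: (@leq_trans (unshuffles w d * ((weight e w - d)`! * d`!))); last first.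
  by rewrite leq_mul2r unshuffles_le ?orbT.
rewrite -sum_unshuffle_const big_seq_cond [leqRHS]big_seq_cond.
apply: leq_sum => p /andP[pw /eqP pd].
have /andP[p1 _] := unshuffle_sub pw ew.
rewrite mulnCA mulnC leq_mul2r; apply/orP; right.
have <- : weight e p.1 = weight e w - d.
  by rewrite -(unshuffle_weight e pw) pd addnK.
exact: IHD.
Qed.

Lemma size_deal_eq D w : all (fun i => e i == 1) w -> sumn D = size w ->
  size (deal e D w) * \prod_(d <- D) d`! = (size w)`!.
Proof.
elim: D w => [|d D IHD] w ew sD.
  by case: w sD ew => // _; rewrite big_nil.
rewrite size_deal_cons big_cons big_distrl /=.
have dw : d <= size w by move: sD => /=; lia.
rewrite -(bin_fact dw) -unshuffles_eq // [d`! * (_ - _)`!]mulnC -sum_unshuffle_const.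
rewrite big_seq_cond [RHS]big_seq_cond.
apply: eq_bigr => p /andP[pw /eqP pd].
have /andP[p1 p2] := unshuffle_sub pw ew.
have sp := perm_size (unshuffle_perm pw); rewrite size_cat in sp.
rewrite weight_size // in pd.
by rewrite mulnCA mulnC IHD //; [congr (_`! * _)|move: sD => /=]; lia.
Qed.

(** Strictness arises at the first nonzero entry of [D]: a heavy letter makes the choices of that
    pile fewer than the binomial coefficient, or the entry exceeds the total weight and nothing can
    be dealt. *)
Lemma size_deal_lt D w : all (fun i => 0 < e i) w ->
    has (fun i => 1 < e i) w -> all (fun d => d != weight e w) D ->
  size (deal e D w) * \prod_(d <- D) d`! < (weight e w)`!.
Proof.
elim: D w => [|d D IHD] w ew ew2 /=.
  by case: w ew ew2 => //= *; rewrite big_nil fact_gt0.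
case/andP=> dw Dw; rewrite -[size _]/(size (deal e (d :: D) w)).
rewrite size_deal_cons big_cons big_distrl /=.
have [d0|d0] := posnP d.
  rewrite d0 fact0 mul1n.
  (* There is at most one unshuffle with a second part of weight 0, so it suffices to bound its
     summand by the factorial minus one. *)
  apply: (@leq_ltn_trans (unshuffles w 0 * ((weight e w)`!.-1))); last first.
    have := unshuffles_le 0 ew; rewrite bin0.
    by have := fact_gt0 (weight e w); case: unshuffles => [|[|]]; lia.
  rewrite -sum_unshuffle_const big_seq_cond [leqRHS]big_seq_cond.
  apply: leq_sum => p /andP[pw /eqP pd].
  have /andP[p1 p2] := unshuffle_sub pw ew.
  have p20 : p.2 = [::].
    by apply/eqP; rewrite -size_eq0 -leqn0 -pd size_le_weight.
  have := unshuffle_perm pw; rewrite p20 cats0 => p1w.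
  have wp : weight e p.1 = weight e w by rewrite /weight (perm_big _ p1w).
  have := IHD p.1 p1; rewrite (perm_has _ p1w) wp => /(_ ew2 Dw).
  by case: ((weight e w)`!).
have [dw'|dw'] := ltnP d (weight e w); last first.
  rewrite big_seq_cond big1 ?fact_gt0 // => p /andP[/(unshuffle_weight e)].
  by lia.
apply: leq_trans (bin_mul_fact _ d).
apply: (@leq_ltn_trans (unshuffles w d * ((weight e w - d)`! * d`!))); last first.
  by rewrite ltn_pmul2r ?unshuffles_lt ?d0 // muln_gt0 !fact_gt0.
rewrite -sum_unshuffle_const big_seq_cond [leqRHS]big_seq_cond.
apply: leq_sum => p /andP[pw /eqP pd].
have /andP[p1 _] := unshuffle_sub pw ew.
rewrite mulnCA mulnC leq_mul2r; apply/orP; right.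
have <- : weight e p.1 = weight e w - d.
  by rewrite -(unshuffle_weight e pw) pd addnK.
exact: size_deal_le.
Qed.

End Counting.
End Words.

(** * Harmonic functions on words *)

Section Coupling.
Variable T : eqType.
Implicit Types (A : pred T) (As : seq (pred T)) (w : seq T).

Definition cut A w := filter (predC A) w ++ filter A w.

Lemma cut_perm A w : perm_eq (cut A w) w.
Proof. by rewrite /cut perm_catC perm_filterC. Qed.

Lemma filter_cut (Q : pred T) A w : filter Q (cut A w) = cut A (filter Q w).
Proof.
rewrite /cut filter_cat -!filter_predI; congr (_ ++ _);
  by apply: eq_filter => x /=; rewrite andbC.
Qed.

Definition same_order w1 w2 i j := filter (pred2 i j) w1 = filter (pred2 i j) w2.

Lemma same_order_cut A w1 w2 i j :
  same_order w1 w2 i j -> same_order (cut A w1) (cut A w2) i j.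
Proof. by rewrite /same_order !filter_cut => ->. Qed.

Lemma filter_cut2 A w i j : uniq w -> i \in w -> j \in w -> A i -> ~~ A j ->
  filter (pred2 i j) (cut A w) = [:: j; i].
Proof.
move=> uw iw jw Ai Aj; rewrite /cut filter_cat -!filter_predI.
rewrite -cat1s; congr (_ ++ _).
  rewrite -(filter_pred1_uniq uw jw); apply: eq_filter => x /=.
  have [->|xj] := eqVneq x j; first by rewrite orbT Aj.
  by rewrite orbF; have [->|//] := eqVneq x i; rewrite Ai.
rewrite -(filter_pred1_uniq uw iw); apply: eq_filter => x /=.
have [->|xi] := eqVneq x i; first by rewrite Ai.
by have [->|//] := eqVneq x j; rewrite (negbTE Aj).
Qed.

(** The head of a word precedes all its other letters, so agreement on pairs forces equal heads;
    induction handles the tails. *)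
Lemma same_order_eq w1 w2 : uniq w1 -> perm_eq w1 w2 ->
  (forall i j, i \in w1 -> j \in w1 -> i != j -> same_order w1 w2 i j) ->
  w1 = w2.
Proof.
elim: w1 w2 => [|i w1 IH] [|j w2] //=; try by move=> _ /perm_size.
move=> /andP[iw1 u1] p12 so.
have jw1 : j \in i :: w1 by rewrite (perm_mem p12) mem_head.
have ij : i = j.
  apply/eqP/negPn/negP => ij.
  have := so i j (mem_head _ _) jw1 ij.
  by rewrite /same_order /= !eqxx orbT /= => -[/eqP]; rewrite (negbTE ij).
rewrite -ij in p12 so *; congr (_ :: _); apply: IH => //.
  by rewrite perm_cons in p12.
move=> x y xw yw xy; have := so x y; rewrite !inE xw yw !orbT => /(_ _ _ xy).
rewrite /same_order /= => /(_ isT isT).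
by case: ifP => // _ [].
Qed.

Definition cuts (As : seq (pred T)) w := foldl (fun u A => cut A u) w As.

Lemma cuts_perm As w : perm_eq (cuts As w) w.
Proof.
elim: As w => [//|A As IH] w /=; exact: perm_trans (IH _) (cut_perm _ _).
Qed.

Lemma same_order_cuts As w1 w2 i j :
  same_order w1 w2 i j -> same_order (cuts As w1) (cuts As w2) i j.
Proof.
by elim: As w1 w2 => [//|A As IH] w1 w2 so; apply: IH; apply: same_order_cut.
Qed.

(* Cutting along [A] orders every pair separated by [A] independently of the
   initial order, and later cuts preserve an agreement of orders. *)
Lemma cuts_merge As w1 w2 : uniq w1 -> perm_eq w1 w2 ->
  (forall i j, i \in w1 -> j \in w1 -> i != j ->
     exists n, n < size As /\ nth xpred0 As n i /\ ~~ nth xpred0 As n j)%N ->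
  cuts As w1 = cuts As w2.
Proof.
move=> u1 p12 sep; have p1 := cuts_perm As w1.
apply: same_order_eq; first by rewrite (perm_uniq p1).
  by rewrite (perm_trans p1) // (perm_trans p12) // perm_sym cuts_perm.
move=> i j; rewrite !(perm_mem p1) => iw jw ij.
have [n [nA [Ai Aj]]] := sep i j iw jw ij.
have {}u2 : uniq w2 by rewrite -(perm_uniq p12).
have iw2 : i \in w2 by rewrite -(perm_mem p12).
have jw2 : j \in w2 by rewrite -(perm_mem p12).
elim: As n nA Ai Aj w1 w2 u1 u2 iw jw iw2 jw2 {p12 p1 sep} => [//|A As IH].
case=> [|n] /= nA Ai Aj w1 w2 u1 u2 iw jw iw2 jw2.
  by apply: same_order_cuts; rewrite /same_order !filter_cut2.
by apply: (IH n) => //; rewrite ?(perm_uniq (cut_perm _ _))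
  ?(perm_mem (cut_perm _ _)).
Qed.

End Coupling.

Lemma exists_max (k : realFieldType) (T : eqType) (F : T -> k) (s : seq T) x0 :
  x0 \in s -> exists2 x, x \in s & forall y, y \in s -> F y <= F x.
Proof.
elim: s x0 => [//|x s IHs] x0 _.
case: s IHs => [_|y s IHs].
  by exists x; rewrite ?mem_head // => z; rewrite inE => /eqP ->.
have [m ms mmax] := IHs y (mem_head _ _).
have [xm|mx] := leP (F x) (F m).
  by exists m => [|z]; rewrite inE ?ms ?orbT // => /orP[/eqP ->|/mmax].
exists x => [|z]; rewrite inE ?eqxx // => /orP[/eqP ->//|/mmax zm].
by rewrite (le_trans zm) // ltW.
Qed.

Lemma sumr_const_seq (V : nmodType) (T : Type) (s : seq T) (v : V) :
  \sum_(i <- s) v = v *+ size s.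
Proof. by rewrite big_const_seq count_predT iter_addr addr0. Qed.

Section Harmonic.
Variables (k : realFieldType) (I : finType) (P : pred I).
Variables (al : I -> k) (D : I -> seq nat) (c : I -> k).
Hypothesis al_ge0 : forall i, P i -> 0 <= al i.

(** When [c i] is the exact number of dealings with pile weights [D i], this is a weighted mean
    value property on the rearrangements of [b]; when [c i] is larger, it forces decay. *)
Definition harmonic (T : eqType) (e : T -> nat) (b : seq T) (G : seq T -> k) :=
  forall w, perm_eq w b ->
    (\sum_(i | P i) al i * c i) * G w =
    \sum_(i | P i) al i * \sum_(u <- deal e (D i) w) G u.

(** At a word where the absolute value of [G] is largest, the equation bounds that value times the
    total weight by the same value times a strictly smaller weight. *)
Lemma harmonic_eq0 (T : eqType) (e : T -> nat) b G : harmonic e b G ->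
    (forall i w, P i -> perm_eq w b -> (size (deal e (D i) w))%:R <= c i) ->
    (exists i, [/\ P i, 0 < al i & forall w, perm_eq w b ->
       (size (deal e (D i) w))%:R < c i]) ->
  G b = 0.
Proof.
move=> hG le_c [i0 [Pi0 ali0 lt_c]].
have base : b \in permutations b by rewrite mem_permutations.
have [w] := exists_max (fun w => `|G w|) base.
rewrite mem_permutations => wb wmax; apply/eqP.
have {wmax} wmax u : perm_eq u b -> `|G u| <= `|G w|.
  by move=> ub; apply: wmax; rewrite mem_permutations.
suff Gw0 : `|G w| <= 0 by rewrite -normr_le0 (le_trans (wmax b _)).
have bound : (\sum_(i | P i) al i * c i) * `|G w| <=
    (\sum_(i | P i) al i * (size (deal e (D i) w))%:R) * `|G w|.
  apply: (@le_trans _ _ `|(\sum_(i | P i) al i * c i) * G w|).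
    by rewrite normrM ler_wpM2r // ler_norm.
  rewrite hG // mulr_suml (le_trans (ler_norm_sum _ _ _)) // ler_sum // => i Pi.
  rewrite normrM (ger0_norm (al_ge0 Pi)) -mulrA ler_wpM2l ?al_ge0 //.
  rewrite (le_trans (ler_norm_sum _ _ _)) //.
  rewrite mulr_natl -sumr_const_seq big_seq [leRHS]big_seq.
  apply: ler_sum => u /deal_perm uw; apply: wmax; exact: perm_trans uw wb.
have lt : \sum_(i | P i) al i * (size (deal e (D i) w))%:R <
    \sum_(i | P i) al i * c i.
  rewrite (bigD1 i0) //= [ltRHS](bigD1 i0) //= ltr_leD ?ltr_pM2l ?lt_c //.
  by apply: ler_sum => i /andP[Pi _]; rewrite ler_wpM2l ?al_ge0 ?le_c.
rewrite leNgt; apply/negP => Gw; move: bound.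
by rewrite ler_pM2r // leNgt lt.
Qed.

(** Maximum principle: the weighted sum of the gaps [G w - G v] over all dealings vanishes and no
    gap is negative, so every gap of positive weight is zero. *)
Lemma harmonic_max (T : eqType) (e : T -> nat) b G : harmonic e b G ->
    (forall i w, P i -> perm_eq w b -> (size (deal e (D i) w))%:R = c i) ->
  forall w, perm_eq w b -> (forall u, perm_eq u b -> G u <= G w) ->
  forall i u, P i -> 0 < al i -> u \in deal e (D i) w -> G u = G w.
Proof.
move=> hG eq_c w wb wmax i u Pi ali ui.
have wmax' j v : v \in deal e (D j) w -> G v <= G w.
  by move=> /deal_perm vw; apply: wmax; exact: perm_trans vw wb.
have ge0 j : 0 <= \sum_(v <- deal e (D j) w) (G w - G v).
  by rewrite big_seq sumr_ge0 // => v vj; rewrite subr_ge0 (wmax' j).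
have : \sum_(j | P j) al j * \sum_(v <- deal e (D j) w) (G w - G v) == 0.
  rewrite (eq_bigr (fun j => al j * c j * G w - al j * \sum_(v <- deal e (D j) w) G v)).
    by rewrite sumrB -mulr_suml hG // subrr.
  move=> j Pj; rewrite sumrB sumr_const_seq -[G w *+ _]mulr_natl eq_c //.
  by rewrite mulrBr mulrA.
rewrite psumr_eq0 => [|j Pj]; last by rewrite mulr_ge0 ?al_ge0.
move=> /allP/(_ i (mem_index_enum _)); rewrite Pi mulf_eq0 gt_eqF //=.
rewrite big_seq_cond psumr_eq0 => [|v /andP[vj _]]; last first.
  by rewrite subr_ge0 (wmax' i).
by move=> /allP/(_ u ui); rewrite ui /= subr_eq0 eq_sym => /eqP.
Qed.

(** The same cuts, along every set of [d] letters in turn, are made from a word where [G] is maximal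
    and from one where it is minimal. The extreme values persist, and the two words end up equal. *)
Lemma harmonic_const (T : finType) (G : seq T -> k) :
    harmonic (fun _ : T => 1%N) (enum T) G ->
    (forall i w, P i -> perm_eq w (enum T) ->
       (size (deal (fun _ : T => 1%N) (D i) w))%:R = c i) ->
    (exists i, [/\ P i, 0 < al i, sumn (D i) = #|T| &
       all (fun d => d != #|T|)%N (D i)]) ->
  forall w1 w2, perm_eq w1 (enum T) -> perm_eq w2 (enum T) -> G w1 = G w2.
Proof.
move=> hG eq_c [i0 [Pi0 ali0 sD nD]].
have [T0|Tgt0] := posnP #|T|.
  move=> w1 w2 /perm_size s1 /perm_size s2; move: s1 s2.
  by rewrite -cardE T0 => /size0nil -> /size0nil ->.
have sE : size (enum T) = #|T| by rewrite -cardE.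
rewrite -sE in sD nD Tgt0.
have [d /andP[d0 dT] cutD] :=
  @deal_filter _ (fun=> 1%N) _ (enum T) (fun=> erefl) sD nD Tgt0.
pose Ad : seq {set T} := enum [set A : {set T} | #|A| == d].
pose As : seq (pred T) := map (fun (A : {set T}) x => x \in A) Ad.
have nthAs m : (m < size Ad)%N -> nth xpred0 As m = (fun x => x \in nth finset.set0 Ad m).
  by move=> mA; apply: (nth_map finset.set0).
have As_d m : (m < size As)%N -> count (nth xpred0 As m) (enum T) = d.
  rewrite size_map => mA; rewrite nthAs //.
  have : nth finset.set0 Ad m \in [set A : {set T} | #|A| == d].
    by rewrite -mem_enum mem_nth.
  rewrite inE => /eqP <-; rewrite -size_filter cardE /enum_mem.
  rewrite -filter_predI; congr size.
  by apply: eq_filter => x; rewrite /= andbT.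
have As_closed (H : seq T -> k) : harmonic (fun _ : T => 1%N) (enum T) H ->
    forall w, perm_eq w (enum T) ->
      (forall u, perm_eq u (enum T) -> H u <= H w) -> H (cuts As w) = H w.
  move=> hH; elim: As {nthAs} As_d => [//|A As IH] As_d w wb wmax /=.
  have HA : H (cut A w) = H w.
    apply: (harmonic_max hH eq_c wb wmax Pi0 ali0).
    apply: cutD; first by rewrite (perm_size wb).
    by rewrite (seq.permP wb); apply: (As_d 0%N).
  rewrite -HA; apply: IH => [m mA||u].
  - exact: (As_d m.+1).
  - exact: perm_trans (cut_perm _ _) wb.
  - by rewrite HA; exact: wmax.
have base : enum T \in permutations (enum T) by rewrite mem_permutations.
have [w1 + w1max] := exists_max G base.
have [w2 + w2min] := exists_max (fun w => - G w) base.
rewrite !mem_permutations => w2b w1b.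
(* The minimum of [G] is treated as the maximum of its negative, which is again harmonic. *)
have hN : harmonic (fun _ : T => 1%N) (enum T) (fun w => - G w).
  move=> w wb; rewrite mulrN hG // -sumrN; apply: eq_bigr => i _.
  by rewrite sumrN mulrN.
have G1 : G (cuts As w1) = G w1.
  by apply: As_closed => // u ub; rewrite w1max ?mem_permutations.
have G2 : G (cuts As w2) = G w2.
  apply: oppr_inj; apply: (As_closed _ hN) => // u ub.
  by rewrite w2min ?mem_permutations.
have Geq : G w1 = G w2.
  rewrite -G1 -G2; congr (G _); apply: cuts_merge.
  - by rewrite (perm_uniq w1b) enum_uniq.
  - by rewrite (perm_trans w1b) // perm_sym.
  move=> i j _ _ ij.
  (* A separating set consists of [i] and [d - 1] letters other than [i] and [j]; there are enough
     of these because [d] is below the number of letters. *)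
  have [A [Ai Aj dA]] : exists A : {set T}, [/\ i \in A, j \notin A & #|A| = d].
    have sd : (d.-1 <= size (enum (~: [set i; j])))%N.
      rewrite -cardE; have := cardsC [set i; j]; rewrite cards2 ij.
      by move: dT; rewrite sE; lia.
    pose s := take d.-1 (enum (~: [set i; j])).
    have us : uniq s by rewrite take_uniq // enum_uniq.
    have sP x : x \in s -> (x != i) && (x != j).
      by move=> /mem_take; rewrite mem_enum !inE negb_or.
    exists (i |: [set x in s]); rewrite !inE eqxx negb_or; split=> //.
      by rewrite eq_sym ij /=; apply/negP => /sP; rewrite eqxx andbF.
    rewrite cardsU1 inE cardsE (card_uniqP us) size_takel //.
    have -> : i \notin s by apply/negP => /sP; rewrite eqxx.
    by rewrite /= add1n prednK.
  have AA : A \in Ad by rewrite mem_enum inE dA.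
  exists (index A Ad).
  by rewrite size_map index_mem AA nthAs ?index_mem // nth_index.
suff Gw w : perm_eq w (enum T) -> G w = G w1.
  by move=> u1 u2 /Gw -> /Gw ->.
move=> wb; apply/eqP; rewrite eq_le w1max ?mem_permutations //= Geq.
by rewrite -lerN2 w2min ?mem_permutations.
Qed.

End Harmonic.

(** * Linear maps out of tensor products *)

Section Linear.
Variables (k : comNzRingType) (U W : lmodType k).

Lemma linear_fun0 (f : U -> W) : linear f -> f 0 = 0.
Proof.
move=> fl; have /eqP := fl 1 0 0; rewrite !scale1r addr0.
by rewrite -subr_eq subrr eq_sym => /eqP.
Qed.

Lemma linear_funD (f : U -> W) : linear f -> {morph f : x y / x + y}.
Proof. by move=> fl x y; have := fl 1 x y; rewrite !scale1r. Qed.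

Lemma linear_funZ (f : U -> W) : linear f -> forall c x, f (c *: x) = c *: f x.
Proof. by move=> fl c x; have := fl c x 0; rewrite (linear_fun0 fl) !addr0. Qed.

Lemma linear_fun_sum (f : U -> W) : linear f ->
  forall (I : Type) (r : seq I) (P : pred I) (F : I -> U),
  f (\sum_(i <- r | P i) F i) = \sum_(i <- r | P i) f (F i).
Proof.
move=> fl I r P F; apply: (big_morph f (linear_funD fl) (linear_fun0 fl)).
Qed.

End Linear.

Section Bilinear.
Variables (k : comNzRingType) (U V W : lmodType k).

Lemma tlift_sum (f : U -> V -> W) : bilinear_map f ->
  forall (I : Type) (r : seq I) (P : pred I) (F : I -> U) (G : I -> V),
  tlift f (\sum_(i <- r | P i) F i ⊗ G i) = \sum_(i <- r | P i) f (F i) (G i).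
Proof.
move=> fb I r P F G; rewrite (linear_fun_sum (tlift_linear fb)).
by apply: eq_bigr => i _; exact: tlift_pure.
Qed.

Lemma pureDl u u' (v : V) : (u + u' : U) ⊗ v = u ⊗ v + u' ⊗ v.
Proof. exact: (linear_funD ((pure_bilinear U V).1 v)). Qed.

Lemma pureDr (u : U) v v' : u ⊗ (v + v' : V) = u ⊗ v + u ⊗ v'.
Proof. exact: (linear_funD ((pure_bilinear U V).2 u)). Qed.

Lemma pureZl c u (v : V) : (c *: u : U) ⊗ v = c *: (u ⊗ v).
Proof. exact: (linear_funZ ((pure_bilinear U V).1 v)). Qed.

Lemma pureZr c (u : U) v : u ⊗ (c *: v : V) = c *: (u ⊗ v).
Proof. exact: (linear_funZ ((pure_bilinear U V).2 u)). Qed.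

Lemma pure0l (v : V) : (0 : U) ⊗ v = 0.
Proof. exact: (linear_fun0 ((pure_bilinear U V).1 v)). Qed.

Lemma pure0r (u : U) : u ⊗ (0 : V) = 0.
Proof. exact: (linear_fun0 ((pure_bilinear U V).2 u)). Qed.

End Bilinear.

Section TensorMaps.
Variables (k : comNzRingType).

Lemma tmap_bilinear (U U' V V' : lmodType k) (f : U -> U') (g : V -> V') :
  linear f -> linear g -> bilinear_map (fun u v => f u ⊗ g v).
Proof.
move=> fl gl; split=> [v c u u'|u c v v'] /=.
  by rewrite fl pureDl pureZl.
by rewrite gl pureDr pureZr.
Qed.

Lemma mul_bilinear (A : algType k) : bilinear_map (fun u v : A => u * v).
Proof.
split=> [v c u u'|u c v v'] /=; first by rewrite mulrDl scalerAl.
by rewrite mulrDr scalerAr.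
Qed.

Lemma tensor_mul_sum (A : algType k) (I J : Type) (r : seq I) (s : seq J)
    (F G : I -> A) (F' G' : J -> A) :
  tensor_mul (\sum_(i <- r) F i ⊗ G i) (\sum_(j <- s) F' j ⊗ G' j) =
  \sum_(i <- r) \sum_(j <- s) (F i * F' j) ⊗ (G i * G' j).
Proof.
have b1 u v : bilinear_map (fun u' v' : A => (u * u') ⊗ (v * v')).
  apply: tmap_bilinear; [exact: (mul_bilinear A).2|exact: (mul_bilinear A).2].
rewrite /tensor_mul tlift_sum.
  by apply: eq_bigr => i _; rewrite tlift_sum.
split=> [v c u u'|u c v v'] /=; rewrite !(tlift_sum (b1 _ _)) scaler_sumr;
  rewrite -big_split; apply: eq_bigr => p _ /=.
  by rewrite mulrDl -scalerAl pureDl pureZl.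
by rewrite mulrDl -scalerAl pureDr pureZr.
Qed.

End TensorMaps.

(** * Products of homogeneous elements of positive degree *)

Section Hopf.
Variables (k : fieldType) (H : graded_hopf k).

Lemma conv_linear (f g : H -> H) : linear f -> linear g -> linear (conv f g).
Proof.
move=> fl gl c x y; rewrite /conv /tmap /tmult linearP.
rewrite (tlift_linear (tmap_bilinear fl gl)).
exact: (tlift_linear (mul_bilinear H)).
Qed.

Lemma conv_sum (f g : H -> H) (x : H) (I : Type) (r : seq I) (F G : I -> H) :
  linear f -> linear g -> Delta x = \sum_(i <- r) F i ⊗ G i ->
  conv f g x = \sum_(i <- r) f (F i) * g (G i).
Proof.
move=> fl gl Dx; rewrite /conv /tmap /tmult Dx (tlift_sum (tmap_bilinear fl gl)).
by rewrite (tlift_sum (mul_bilinear H)).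
Qed.

(** Left unit law of convolution; it reconciles [conv_seq], which starts from its first factor, with
    [conv_proj], which starts from the unit. *)
Lemma conv_counitl (g : H -> H) : linear g ->
  conv (fun x : H => counit x *: (1 : H)) g = g.
Proof.
move=> gl; apply/funext => x.
have cl : linear (fun x : H => counit x *: (1 : H)).
  by move=> c u v; rewrite linearP scalerDl scalerA.
have cb : bilinear_map (fun u v : H => counit u *: v).
  split=> [v c u u'|u c v v'] /=; first by rewrite linearP scalerDl scalerA.
  by rewrite scalerDr !scalerA mulrC.
have [r Dx] : exists r, Delta x = \sum_(p <- r) p.1 ⊗ p.2.
  by exists (repr (Delta x)); exact: tensor_pureE.
rewrite (conv_sum cl gl Dx) -[in RHS](counitl x) Dx (tlift_sum cb).
rewrite (linear_fun_sum gl); apply: eq_bigr => p _.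
by rewrite -scalerAl mul1r (linear_funZ gl).
Qed.

Hypothesis H_connected : connected H.

Lemma homog0_scalar (x : H) : homog 0 x -> exists c : k, x = c *: 1.
Proof.
have [e [_ _ e0]] := H_connected.
have [c c1] := e0 1 (graded1 H).
have c0 : c != 0.
  by apply: contraNneq (oner_neq0 H) => c0; rewrite c1 c0 scale0r.
move=> /e0[b ->]; exists (b / c).
by rewrite [in RHS]c1 scalerA divfK.
Qed.

Lemma homogD d (x y : H) : homog d x -> homog d y -> homog d (x + y).
Proof. by rewrite /homog linearD => -> ->. Qed.

Lemma homogZ d c (x : H) : homog d x -> homog d (c *: x).
Proof. by rewrite /homog linearZ => /= ->. Qed.

Lemma homog_zero d : homog d (0 : H).
Proof. by rewrite /homog linear0. Qed.

(** The degree is carried along with the element because 0 is homogeneous of every degree. *)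
Definition pos_homog (y : nat * H) : bool :=
  (0 < y.1)%N && (Proj H y.1 y.2 == y.2).

Local Notation hword := (all pos_homog).
Local Notation deg := (@weight (nat * H) fst).
Local Notation eval w := (\prod_(y <- w) y.2).

(** By connectedness, terms with a factor of degree 0 collect into [b ⊗ 1 + 1 ⊗ a]; the two counit
    laws then force [a] and [b] to be [x]. *)
Lemma Delta_pos d (x : H) : homog d x -> (0 < d)%N ->
  exists s : seq ((nat * H) * (nat * H)),
    Delta x = x ⊗ 1 + 1 ⊗ x + \sum_(p <- s) p.1.2 ⊗ p.2.2 /\
    forall p, p \in s ->
      [/\ pos_homog p.1, pos_homog p.2 & (p.1.1 + p.2.1)%N = d].
Proof.
move=> hx d0; have [s [Ds hs]] := graded_Delta hx.
have [a [b [t [ha hb st ht]]]] : exists (a b : H) (t : seq ((nat * H) * (nat * H))),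
    [/\ homog d a, homog d b,
      \sum_(p <- s) p.1 ⊗ p.2 = b ⊗ 1 + 1 ⊗ a + \sum_(p <- t) p.1.2 ⊗ p.2.2 &
      forall p, p \in t ->
        [/\ pos_homog p.1, pos_homog p.2 & (p.1.1 + p.2.1)%N = d]].
  elim: s hs {Ds} => [|p s IHs] hs.
    exists 0, 0, [::]; split=> //; try exact: homog_zero.
    by rewrite !big_nil pure0l pure0r !addr0.
  have [|a [b [t [ha hb st ht]]]] := IHs.
    by move=> q qs; apply: hs; rewrite inE qs orbT.
  have [i [j [ij hi hj]]] := hs p (mem_head _ _).
  rewrite big_cons st.
  have [i0|i0] := posnP i.
    have [|c pc] := @homog0_scalar p.1; first by rewrite /homog -i0.
    exists (c *: p.2 + a), b, t; split=> //.
      by apply: homogD => //; apply: homogZ; rewrite /homog -ij i0.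
    by rewrite pc pureZl pureDr pureZr -!addrA [LHS]addrCA.
  have [j0|j0] := posnP j.
    have [|c pc] := @homog0_scalar p.2; first by rewrite /homog -j0.
    exists a, (c *: p.1 + b), t; split=> //.
      by apply: homogD => //; apply: homogZ; rewrite /homog -ij j0 addn0.
    by rewrite pc pureZr pureDl pureZl -!addrA.
  exists a, b, (((i, p.1), (j, p.2)) :: t); split=> //.
    by rewrite big_cons /= addrCA.
  move=> q; rewrite inE => /orP[/eqP -> /=|/ht//].
  by rewrite /pos_homog /= i0 j0 hi hj !eqxx.
have c0 (y : nat * H) : pos_homog y -> counit y.2 = 0.
  by move=> /andP[y0 /eqP hy]; apply: (graded_counit hy); rewrite -lt0n.
have dn0 : d != 0%N by rewrite -lt0n.
have cbl : bilinear_map (fun u v : H => counit u *: v).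
  split=> [v c u u'|u c v v'] /=; first by rewrite linearP scalerDl scalerA.
  by rewrite scalerDr !scalerA mulrC.
have cbr : bilinear_map (fun u v : H => counit v *: u).
  split=> [v c u u'|u c v v'] /=; first by rewrite scalerDr !scalerA mulrC.
  by rewrite linearP scalerDl scalerA.
have xa : x = a.
  have := counitl x; rewrite Ds st !(linear_funD (tlift_linear cbl)).
  rewrite !(tlift_pure _ _ cbl) (tlift_sum cbl) (graded_counit hb dn0).
  rewrite counit1 scale0r scale1r add0r big_seq big1 ?addr0 // => p /ht[h1 _ _].
  by rewrite c0 // scale0r.
have xb : x = b.
  have := counitr x; rewrite Ds st !(linear_funD (tlift_linear cbr)).
  rewrite !(tlift_pure _ _ cbr) (tlift_sum cbr) (graded_counit ha dn0).
  rewrite counit1 scale0r scale1r addr0 big_seq big1 ?addr0 // => p /ht[_ h1 _].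
  by rewrite c0 // scale0r.
by exists t; split=> //; rewrite Ds st -xa -xb.
Qed.

Lemma eval_cat (u v : seq (nat * H)) : eval (u ++ v) = eval u * eval v.
Proof. exact: big_cat. Qed.

Lemma eval_homog w : hword w -> homog (deg w) (eval w).
Proof.
elim: w => [|y w IHw] /=.
  by rewrite /weight !big_nil => _; exact: graded1.
case/andP=> /andP[_ /eqP hy] /IHw hw.
by rewrite weight_cons big_cons; exact: gradedM.
Qed.

Lemma Proj_homog d e (x : H) : homog d x -> Proj H e x = if e == d then x else 0.
Proof. by move=> hx; rewrite -{1}hx ProjK hx. Qed.

Lemma Proj_eval d w : hword w ->
  Proj H d (eval w) = if deg w == d then eval w else 0.
Proof. by move=> /eval_homog /(Proj_homog d) ->; rewrite eq_sym. Qed.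

(** Multiplying out the coproducts of the factors, the terms in which every factor goes whole to one
    side are the unshuffles; in any other term some factor is broken in two, which raises the number
    of factors. *)
Lemma Delta_eval w : hword w ->
  exists s : seq (seq (nat * H) * seq (nat * H)),
    Delta (eval w) = \sum_(p <- unshuffle w ++ s) eval p.1 ⊗ eval p.2 /\
    forall p, p \in s -> [/\ hword p.1, hword p.2, (deg p.1 + deg p.2)%N = deg w &
      (size w < size p.1 + size p.2)%N].
Proof.
elim: w => [|y w IHw] /=.
  by exists [::]; split=> [|p] //=; rewrite big_seq1 !big_nil Delta1.
case/andP=> hy hw; have [s [Ds hs]] := IHw hw.
have /andP[y0 /eqP hy2] := hy.
have [t [Dt ht]] := Delta_pos hy2 y0.
(* In the first two lists [y] stays whole beside a term that was already longer; in the third [y]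
   itself is broken. *)
exists ([seq (y :: m.1, m.2) | m <- s] ++ [seq (m.1, y :: m.2) | m <- s] ++
  [seq (q.1 :: m.1, q.2 :: m.2) | q <- t, m <- unshuffle w ++ s]).
split.
  pose L : seq (seq (nat * H) * seq (nat * H)) :=
    [:: ([:: y], [::]); ([::], [:: y])] ++ [seq ([:: q.1], [:: q.2]) | q <- t].
  have DL : Delta y.2 = \sum_(l <- L) eval l.1 ⊗ eval l.2.
    rewrite Dt big_cat !big_cons !big_nil /= !mulr1 addr0 big_map; congr (_ + _).
    by apply: eq_bigr => q _; rewrite !big_seq1.
  rewrite big_cons DeltaM DL Ds tensor_mul_sum.
  transitivity (\sum_(l <- L) \sum_(m <- unshuffle w ++ s)
      eval (l.1 ++ m.1) ⊗ eval (l.2 ++ m.2)).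
    by apply: eq_bigr => l _; apply: eq_bigr => m _; rewrite !eval_cat.
  rewrite big_cat /= !big_cons !big_nil /= addr0 !big_cat !big_map big_allpairs_dep /=.
  by rewrite addrACA -!addrA.
move=> p; rewrite !mem_cat => /or3P[
  /mapP[m /hs[m1 m2 md ms] ->]|/mapP[m /hs[m1 m2 md ms] ->]|] /=.
- by rewrite hy m1 m2 !weight_cons addSn ltnS -addnA md.
- by rewrite hy m1 m2 !weight_cons addnS ltnS addnCA md.
case/allpairsP => -[q m] /= [/ht[q1 q2 qd] mM ->] /=.
have [m1 m2 md ms] : [/\ hword m.1, hword m.2, (deg m.1 + deg m.2)%N = deg w &
    (size w <= size m.1 + size m.2)%N].
  move: mM; rewrite mem_cat => /orP[mw|/hs[-> -> -> /ltnW]//].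
  have /andP[-> ->] := unshuffle_sub mw hw.
  by rewrite (unshuffle_weight _ mw) -size_cat (perm_size (unshuffle_perm mw)).
by rewrite q1 q2 m1 m2 !weight_cons addSn addnS !ltnS addnACA qd md.
Qed.

(** For positive [r] and connected [H] this is the power with exponent [r] of the augmentation
    ideal; scalars are absorbed into a factor. *)
Definition longspan r (v : H) :=
  exists s : seq (seq (nat * H)),
    (forall w, w \in s -> hword w && (r <= size w)%N) /\ v = \sum_(w <- s) eval w.

Lemma longspan0 r : longspan r 0.
Proof. by exists [::]; rewrite big_nil. Qed.

Lemma longspanD r u v : longspan r u -> longspan r v -> longspan r (u + v).
Proof.
move=> [s [hs ->]] [t [ht ->]]; exists (s ++ t); rewrite big_cat; split=> // w.
by rewrite mem_cat => /orP[/hs|/ht].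
Qed.

Lemma longspan_sum r (I : eqType) (s : seq I) (F : I -> H) :
  (forall i, i \in s -> longspan r (F i)) -> longspan r (\sum_(i <- s) F i).
Proof.
move=> hF; rewrite big_seq; elim/big_ind: _ => //; first exact: longspan0.
exact: longspanD.
Qed.

Lemma longspan_le r r' v : (r' <= r)%N -> longspan r v -> longspan r' v.
Proof.
move=> rr' [s [hs ->]]; exists s; split=> // w /hs /andP[-> /=].
exact: leq_trans.
Qed.

Lemma longspan_eval w : hword w -> longspan (size w) (eval w).
Proof.
move=> hw; exists [:: w]; rewrite big_seq1; split=> // u.
by rewrite inE => /eqP ->; rewrite hw leqnn.
Qed.

Lemma longspan_mul r v w : hword w -> longspan r v ->
  longspan (r + size w) (v * eval w).
Proof.
move=> hw [s [hs ->]]; exists [seq u ++ w | u <- s]; split=> [u|].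
  case/mapP=> z /hs/andP[hz rz] ->.
  by rewrite all_cat hz hw size_cat leq_add2r.
by rewrite mulr_suml big_map; apply: eq_bigr => u _; rewrite eval_cat.
Qed.

(* [D] lists the degrees from the last to the first. *)
Definition conv_proj (D : seq nat) : H -> H :=
  foldr (fun d F => conv F (Proj H d)) (fun x : H => counit x *: (1 : H)) D.

Lemma conv_proj_linear D : linear (conv_proj D).
Proof.
elim: D => [|d D IHD] /=.
  by move=> c u v; rewrite linearP scalerDl scalerA.
by apply: conv_linear => //; exact: linearP.
Qed.

Lemma conv_seqE (D : seq nat) : (0 < size D)%N ->
  conv_seq [seq (Proj H d : H -> H) | d <- D] = conv_proj (rev D).
Proof.
rewrite /conv_proj -foldl_rev revK; case: D => [//|d D] _ /=.
rewrite conv_counitl; last exact: linearP.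
by elim: D (Proj H d : H -> H) => [//|e D IHD] f /=; rewrite IHD.
Qed.

(** The last projection selects the unshuffles whose second part has degree [d]; that part becomes
    the last pile and induction deals the first part. All other terms of the coproduct have gained a
    factor. *)
Lemma conv_proj_eval D w : hword w ->
  longspan (size w).+1 (conv_proj D (eval w) - \sum_(u <- deal fst D w) eval u).
Proof.
elim: D w => [|d D IHD] w hw.
  case: w hw => [|y w] hw; rewrite /= ?big_nil ?big_seq1 ?subr0.
    by rewrite big_nil counit1 scale1r subrr; exact: longspan0.
  rewrite (graded_counit (eval_homog hw)) ?scale0r; first exact: longspan0.
  rewrite weight_cons -lt0n; have /andP[/andP[y0 _] _] := hw.
  exact: leq_trans y0 (leq_addr _ _).
(* A cruder form of the induction hypothesis, sufficient for coproduct terms that already have an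
   extra factor. *)
have {}IHD' u : hword u -> longspan (size u) (conv_proj D (eval u)).
  move=> hu; rewrite -[conv_proj D _](subrK (\sum_(z <- deal fst D u) eval z)).
  apply: longspanD; first exact: longspan_le (IHD u hu).
  apply: longspan_sum => z /deal_perm zu; rewrite -(perm_size zu).
  by apply: longspan_eval; rewrite (perm_all _ zu).
have [s [Ds hs]] := Delta_eval hw.
rewrite /= (conv_sum (conv_proj_linear D) (linearP (Proj H d)) Ds).
rewrite -[flatten _]/(deal fst (d :: D) w) sum_deal [X in _ - X]big_mkcond /=.
rewrite big_cat /= addrAC -sumrB; apply: longspanD; apply: longspan_sum => p.
  move=> pw; have /andP[p1 p2] := unshuffle_sub pw hw.
  rewrite Proj_eval //; case: eqP => _; last first.
    by rewrite mulr0 subr0; exact: longspan0.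
  rewrite -(perm_size (unshuffle_perm pw)) size_cat -addSn.
  rewrite (eq_bigr (fun u => eval u * eval p.2)) => [|u _]; last exact: eval_cat.
  rewrite -mulr_suml -mulrBl; apply: longspan_mul => //; exact: IHD.
move=> /hs[p1 p2 _ sp]; rewrite Proj_eval //; case: eqP => _; last first.
  by rewrite mulr0; exact: longspan0.
by apply: longspan_le sp _; apply: longspan_mul => //; exact: IHD'.
Qed.

End Hopf.

Local Notation hword := (all (@pos_homog _ _)).
Local Notation deg := (@weight (nat * _) fst).
Local Notation eval w := (\prod_(y <- w) y.2).

Lemma perm_enumP n (w : seq 'I_n) : perm_eq w (enum 'I_n) ->
  exists t : 'S_n, w = [seq t i | i <- enum 'I_n].
Proof.
move=> wp; have sw : size w = n by rewrite (perm_size wp) size_enum_ord.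
have uw : uniq w by rewrite (perm_uniq wp) enum_uniq.
have inj : injective (fun i : 'I_n => nth i w i).
  move=> i j /eqP; rewrite (set_nth_default j) ?sw // nth_uniq ?sw //.
  by move=> /eqP/val_inj.
exists (perm inj); case: n w wp sw uw inj => [|n] w wp sw uw inj.
  transitivity ([::] : seq 'I_0); first exact: size0nil.
  by apply/esym/size0nil; rewrite size_map size_enum_ord.
apply: (@eq_from_nth _ ord0) => [|i].
  by rewrite size_map size_enum_ord.
rewrite sw => i_n; rewrite (nth_map ord0) ?size_enum_ord // permE.
by rewrite !nth_enum_ord //; apply: set_nth_default; rewrite sw.
Qed.

Lemma perm_enum_map n (s : 'S_n) : perm_eq [seq s i | i <- enum 'I_n] (enum 'I_n).
Proof.
apply: uniq_perm; rewrite ?enum_uniq ?(map_inj_uniq perm_inj) ?enum_uniq //.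
move=> i; rewrite mem_enum inE; apply/mapP; exists (s^-1%g i); rewrite ?mem_enum //.
by rewrite permKV.
Qed.

Section Basis.
Variables (k : fieldType) (H : graded_hopf k) (B : graded_basis H).

Lemma coord_homog m n (y : B m) (v : H) : homog n v -> m != n ->
  Defs.coord y v = 0.
Proof.
move=> hv mn; rewrite (bvec_span B hv) linear_sum big1 // => x _.
rewrite linearZ /= coord_bvec; case: eqP => [/(congr1 tag)/= /eqP|]; last first.
  by rewrite mulr0n scaler0.
by rewrite (negbTE mn).
Qed.

Lemma coord_bvec_same n (x y : B n) : Defs.coord y (bvec x) = (y == x)%:R.
Proof. by rewrite coord_bvec eq_Tagged /=. Qed.

(** A product of more than [n] factors of positive degree has degree above [n]. *)
Lemma coord_longspan n (y : B n) v : longspan n.+1 v -> Defs.coord y v = 0.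
Proof.
case=> s [hs ->]; rewrite linear_sum big_seq big1 // => w /hs/andP[hw nw].
apply: (coord_homog _ (eval_homog hw)); rewrite ltn_eqF //.
apply: leq_trans nw _; apply: size_le_weight.
by apply: sub_all hw => u /andP[].
Qed.

End Basis.

(** * The action of [Psi] on products and its eigenvectors *)

Section Eigenvectors.
Variables (k : realFieldType) (H : graded_hopf k).
Hypothesis H_connected : connected H.
Variables (B : graded_basis H) (a n : nat) (alpha : a.-tuple 'I_n.+1 -> k).
Hypothesis alpha_nonneg : nonneg_convolution alpha.

(** Reversed because [deal] and [conv_proj] expect the last pile first. *)
Definition parts (D : a.-tuple 'I_n.+1) : seq nat := rev [seq val d | d <- D].

Lemma sumn_parts D : weak_composition D -> sumn (parts D) = n.
Proof.
rewrite /weak_composition /parts sumn_rev sumnE big_map big_tuple.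
exact: eqP.
Qed.

Definition multinomial (D : a.-tuple 'I_n.+1) : k :=
  n`!%:R / \prod_(i < a) (tnth D i)`!%:R.

Lemma multinomialE D : multinomial D = n`!%:R / (\prod_(d <- parts D) d`!)%N%:R.
Proof.
congr (_ / _); rewrite natr_prod (perm_big _ (_ : perm_eq _ [seq val d | d <- D])).
  by rewrite big_map big_tuple.
by rewrite perm_rev.
Qed.

Lemma prod_fact_gt0 (s : seq nat) : (0 : k) < (\prod_(d <- s) d`!)%N%:R.
Proof.
by rewrite ltr0n; apply: prodn_cond_gt0 => i _; exact: fact_gt0.
Qed.

Lemma multinomial_gt0 D : 0 < multinomial D.
Proof. by rewrite multinomialE divr_gt0 ?prod_fact_gt0 // ltr0n fact_gt0. Qed.

Lemma beta_gt0 : 0 < beta alpha.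
Proof.
have [_ a0 [D [wD aD _]]] := alpha_nonneg.
rewrite /beta (bigD1 D) //=; apply: ltr_pwDl.
  by rewrite mulr_gt0 // -/(multinomial D) multinomial_gt0.
apply: sumr_ge0 => E /andP[wE _].
by rewrite mulr_ge0 ?a0 // -/(multinomial E) ltW ?multinomial_gt0.
Qed.

Lemma PsiE (v : H) :
  Psi alpha v = \sum_(D | weak_composition D) alpha D *: conv_proj (parts D) v.
Proof.
have [a2 _ _] := alpha_nonneg.
apply: eq_bigr => D _; congr (_ *: _).
rewrite /parts -conv_seqE ?size_map ?size_tuple ?(leq_trans _ a2) //.
by rewrite -map_comp.
Qed.

Lemma Psi_linear : linear (Psi alpha : H -> H).
Proof.
move=> c u v; rewrite !PsiE scaler_sumr -big_split; apply: eq_bigr => D _ /=.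
by rewrite conv_proj_linear scalerDr !scalerA mulrC.
Qed.

Lemma parts_nontrivial : exists D,
  [/\ weak_composition D, 0 < alpha D & all (fun d => d != n)%N (parts D)].
Proof.
have [_ _ [D [wD aD nD]]] := alpha_nonneg; exists D; split=> //.
apply/allP => d; rewrite mem_rev => /mapP[i /tnthP[j ->] ->]; exact: nD.
Qed.

Section Functional.
Variable F : {linear H -> k^o}.

Lemma eval_Psi w : hword w ->
    (forall v, longspan (size w).+1 v -> F v = 0) ->
  F (Psi alpha (eval w)) =
  \sum_(D | weak_composition D)
    alpha D * \sum_(u <- deal fst (parts D) w) F (eval u).
Proof.
move=> hw F0; rewrite PsiE linear_sum; apply: eq_bigr => D _.
rewrite linearZ /=; congr (_ * _); apply/eqP; rewrite -subr_eq0.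
by rewrite -linear_sum -linearB F0 //; apply: conv_proj_eval.
Qed.

Lemma size_deal_multinomial (D : a.-tuple 'I_n.+1) (w : seq 'I_n) :
  weak_composition D -> perm_eq w (enum 'I_n) ->
  (size (deal (fun _ : 'I_n => 1%N) (parts D) w))%:R = multinomial D.
Proof.
move=> wD wp; have sw : size w = n by rewrite (perm_size wp) size_enum_ord.
rewrite multinomialE; apply: (mulIf (lt0r_neq0 (prod_fact_gt0 (parts D)))).
rewrite divfK ?(lt0r_neq0 (prod_fact_gt0 _)) // -natrM.
by rewrite size_deal_eq ?sw ?sumn_parts //; apply/allP.
Qed.

(** Words are written in positions instead of basis elements, so that letters stay distinct when [c]
    has repetitions. *)
Definition letters (c : n.-tuple (B 1%N)) (w : seq 'I_n) : seq (nat * H) :=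
  [seq (1%N, bvec (tnth c i)) | i <- w].

Lemma letters_hword c w : hword (letters c w).
Proof.
rewrite all_map; apply/allP => i _; rewrite /= /pos_homog /=.
by apply/eqP; exact: bvec_homog.
Qed.

Lemma eval_letters c w : eval (letters c w) = \prod_(i <- w) bvec (tnth c i).
Proof. by rewrite big_map. Qed.

Lemma letters_homog c w : size w = n -> homog n (eval (letters c w)).
Proof.
move=> sw; have dw : deg (letters c w) = n.
  by rewrite weight_size ?size_map // all_map; apply/allP.
by rewrite -[X in homog X _]dw; apply: eval_homog; exact: letters_hword.
Qed.

Lemma eval_letters_perm c (s : 'S_n) :
  \prod_(i < n) bvec (tnth c (s i)) = eval (letters c [seq s i | i <- enum 'I_n]).
Proof. by rewrite eval_letters big_map enumT [index_enum _]unlock. Qed.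

Lemma Psi_letters c w : (forall v, longspan n.+1 v -> F v = 0) ->
    perm_eq w (enum 'I_n) ->
  F (Psi alpha (eval (letters c w))) =
  \sum_(D | weak_composition D) alpha D *
    \sum_(u <- deal (fun=> 1%N) (parts D) w) F (eval (letters c u)).
Proof.
move=> F0 wp; rewrite eval_Psi ?letters_hword //; last first.
  by rewrite size_map (perm_size wp) size_enum_ord.
by apply: eq_bigr => D _; rewrite /letters deal_map big_map.
Qed.

End Functional.

Definition symprod (c : n.-tuple (B 1%N)) : H :=
  \sum_(s : 'S_n) \prod_(i < n) bvec (tnth c (s i)).

Lemma symprod_homog c : homog n (symprod c).
Proof.
rewrite /homog linear_sum; apply: eq_bigr => s _.
rewrite eval_letters_perm; apply: letters_homog.
by rewrite size_map size_enum_ord.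
Qed.

(** Coordinates in degree [n] kill longer products, so [Psi] acts by dealing. Each dealing permutes
    the positions, which the sum over all permutations absorbs, and [beta] counts the dealings with
    their weights. *)
Lemma symprod_eigen c (y : B n) :
  Defs.coord y (Psi alpha (symprod c)) = beta alpha * Defs.coord y (symprod c).
Proof.
have F0 v : longspan n.+1 v -> Defs.coord y v = 0 by exact: coord_longspan.
pose g w : k := Defs.coord y (eval (letters c w)).
rewrite /symprod (linear_fun_sum Psi_linear) !linear_sum /beta mulr_suml.
under eq_bigr => s _ do rewrite eval_letters_perm (Psi_letters c F0 (perm_enum_map s)).
rewrite exchange_big /=; apply: eq_bigr => D wD; rewrite -mulr_sumr -mulrA.
congr (_ * _); rewrite -/(multinomial D).
rewrite (eq_bigr (fun s : 'S_n => \sum_(u <- deal (fun=> 1%N) (parts D) (enum 'I_n))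
    g [seq s i | i <- u])) => [|s _]; last first.
  by rewrite (deal_map s) big_map.
rewrite exchange_big /= big_seq.
rewrite (eq_bigr (fun=> \sum_(s : 'S_n) g [seq s i | i <- enum 'I_n])); last first.
  move=> u /deal_perm/perm_enumP[t ->].
  rewrite (reindex_inj (mulgI t^-1%g)) /=; apply: eq_bigr => s _.
  congr (g _); rewrite -map_comp; apply: eq_map => i /=.
  by rewrite permM permK.
rewrite -big_seq sumr_const_seq -mulr_natl size_deal_multinomial //.
by congr (_ * _); apply: eq_bigr => s _; rewrite eval_letters_perm.
Qed.

(** * Dual eigenvectors orthogonal to the symmetrised products *)

Section Dual.
Variable f : B n -> k.
Hypothesis f_eigen : forall x,
  \sum_y Defs.coord y (Psi alpha (bvec x)) * f y = beta alpha * f x.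
Hypothesis f_symprod : forall c, \sum_y f y * Defs.coord y (symprod c) = 0.

Definition functional (v : H) : k^o := \sum_y f y * Defs.coord y v.

Lemma functional_linear : linear functional.
Proof.
move=> c u v; rewrite /functional scaler_sumr -big_split; apply: eq_bigr => y _.
by rewrite linearP /= mulrDr mulrCA.
Qed.

HB.instance Definition _ :=
  GRing.isLinear.Build k H k^o *:%R functional functional_linear.

Lemma functional_eigen v : homog n v ->
  functional (Psi alpha v) = beta alpha * functional v.
Proof.
move=> hv; rewrite (bvec_span B hv) (linear_fun_sum Psi_linear) !linear_sum mulr_sumr.
apply: eq_bigr => x _; rewrite (linear_funZ Psi_linear) !linearZ /= mulrCA.
congr (_ * _); rewrite {2}/functional (bigD1 x) //= big1 => [|y yx].
  rewrite coord_bvec_same eqxx mulr1 addr0 -f_eigen.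
  by apply: eq_bigr => y _; rewrite mulrC.
by rewrite coord_bvec_same (negbTE yx) mulr0.
Qed.

Lemma functional_long v : longspan n.+1 v -> functional v = 0.
Proof. by move=> vl; apply: big1 => y _; rewrite coord_longspan ?mulr0. Qed.

Lemma functional_degree w : hword w -> deg w != n -> functional (eval w) = 0.
Proof.
move=> hw dw; apply: big1 => y _.
by rewrite (coord_homog _ (eval_homog hw)) ?mulr0 // eq_sym.
Qed.

(** As a function of the order of the positions, the value is harmonic, hence constant; its [n!]
    equal values add up to the value at a symmetrised product, which is 0. *)
Lemma functional_basis_word (u : seq (B 1%N)) : size u = n ->
  functional (\prod_(b <- u) bvec b) = 0.
Proof.
move=> /eqP su; pose c : n.-tuple (B 1%N) := Tuple su.
pose G w : k := functional (eval (letters c w)).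
have hG : harmonic (@weak_composition _ _) alpha parts multinomial
    (fun=> 1%N) (enum 'I_n) G.
  move=> w wp; rewrite -[\sum_(_ | _) _]/(beta alpha) -functional_eigen.
    by apply: (Psi_letters c _ wp); exact: functional_long.
  by apply: letters_homog; rewrite (perm_size wp) size_enum_ord.
have [_ al0 _] := alpha_nonneg.
have Gc := harmonic_const al0 hG size_deal_multinomial _.
have {}Gc : forall w1 w2, perm_eq w1 (enum 'I_n) -> perm_eq w2 (enum 'I_n) -> G w1 = G w2.
  apply: Gc; have [D [wD aD nD]] := parts_nontrivial; exists D.
  by rewrite card_ord sumn_parts.
have : functional (symprod c) = 0 by exact: f_symprod.
rewrite linear_sum (eq_bigr (fun=> G (enum 'I_n))) => [|s _]; last first.
  by rewrite eval_letters_perm; apply: Gc; rewrite ?perm_enum_map.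
rewrite sumr_const => /eqP; rewrite mulrn_eq0 card_Sn.
rewrite gtn_eqF ?fact_gt0 //= => /eqP; rewrite /G eval_letters.
by rewrite -(big_map (tnth c) predT (fun b => bvec b)) map_tnth_enum.
Qed.

(** Factors of degree one are expanded in the basis one at a time and moved to the prefix [u]. *)
Lemma functional_ones (u : seq (B 1%N)) w : hword w ->
    all (fun y => y.1 == 1%N) w -> (size u + size w)%N = n ->
  functional ((\prod_(b <- u) bvec b) * eval w) = 0.
Proof.
elim: w u => [|y w IHw] u /=.
  by rewrite big_nil mulr1 addn0 => _ _; exact: functional_basis_word.
case/andP=> /andP[_ /eqP hy] hw /andP[/eqP y1 w1] suw.
rewrite y1 in hy; rewrite big_cons mulrA (bvec_span B hy) mulr_sumr mulr_suml.
rewrite linear_sum big1 // => b _.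
have E : \prod_(b' <- u) bvec b' * bvec b = \prod_(b' <- rcons u b) bvec b'.
  by rewrite -cats1 big_cat big_seq1.
rewrite -scalerAr -scalerAl linearZ /= E (IHw (rcons u b)) ?scaler0 //.
by rewrite size_rcons addSnnS.
Qed.

Lemma functional_word w : hword w -> (0 < size w)%N -> functional (eval w) = 0.
Proof.
(* Descending induction on the number of factors: for [m] equal to 0 there are more than [n] of
   them, and [m] equal to [n] covers all nonempty products. *)
suff gen m u : hword u -> (0 < size u)%N -> (n.+1 - m <= size u)%N ->
    functional (eval u) = 0.
  by move=> hw w0; apply: (gen n) => //; rewrite subSnn.
elim: m u => [|m IHm] {}w hw w0.
  rewrite subn0 => nw; apply: functional_long.
  by apply: longspan_le nw _; exact: longspan_eval.
rewrite subSS leq_eqVlt => /orP[/eqP sw|]; last first.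
  by move=> nmw; apply: IHm => //; lia.
(* Since longer products are already killed, [Psi] can be replaced by dealing on the factors of
   [w]. *)
have F0 v : longspan (size w).+1 v -> functional v = 0.
  case=> s [hs ->]; rewrite linear_sum big_seq big1 // => z /hs/andP[hz zw].
  by apply: IHm => //; apply: leq_trans zw; rewrite -?sw //; lia.
have [dw|/(functional_degree hw)//] := eqVneq (deg w) n.
have pw : all (fun y => 0 < y.1)%N w by apply: sub_all hw => y /andP[].
have [w1|w2] := boolP (all (fun y => y.1 == 1%N) w).
  have := @functional_ones [::] w hw w1; rewrite big_nil mul1r; apply.
  by rewrite -dw weight_size.
have {}w2 : has (fun y => 1 < y.1)%N w.
  apply: contraR w2 => /hasPn w2; apply/allP => y yw.
  by have := w2 y yw; have := allP pw y yw; rewrite -leqNgt eqn_leq => -> ->.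
have [_ al0 _] := alpha_nonneg.
have le_mul D (z : nat) : (z * \prod_(d <- parts D) d`! <= n`!)%N -> z%:R <= multinomial D.
  by move=> zn; rewrite multinomialE ler_pdivlMr ?prod_fact_gt0 // -natrM ler_nat.
have lt_mul D (z : nat) : (z * \prod_(d <- parts D) d`! < n`!)%N -> z%:R < multinomial D.
  by move=> zn; rewrite multinomialE ltr_pdivlMr ?prod_fact_gt0 // -natrM ltr_nat.
have degp u : perm_eq u w -> deg u = n by move=> uw; rewrite -dw /weight (perm_big _ uw).
(* Some factor has degree at least 2, so the dealings respecting the factors fall short of the
   multinomial count and the contraction argument applies. *)
apply: (harmonic_eq0 (G := fun u => functional (eval u)) (e := fst) (D := parts)
  (c := multinomial) (b := w) al0).
- move=> u uw; have hu : hword u by rewrite (perm_all _ uw).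
  rewrite -[\sum_(_ | _) _]/(beta alpha) -functional_eigen.
    by apply: eval_Psi => // v; rewrite (perm_size uw); exact: F0.
  by rewrite -[X in homog X]( degp u uw); exact: eval_homog.
- move=> D u wD uw; apply: le_mul; rewrite -(degp u uw).
  by apply: size_deal_le; rewrite (perm_all _ uw).
have [D [wD aD nD]] := parts_nontrivial; exists D; split=> // u uw.
apply: lt_mul; rewrite -(degp u uw); apply: size_deal_lt.
- by rewrite (perm_all _ uw).
- by rewrite (perm_has _ uw).
- by rewrite (degp u uw).
Qed.

(** A basis element of positive degree is itself a product with a single factor. *)
Lemma functional_eq0 x : (0 < n)%N -> f x = 0.
Proof.
move=> n0; have hx : hword [:: (n, bvec x)].
  by rewrite /= /pos_homog n0 /= andbT; apply/eqP; exact: bvec_homog.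
have := functional_word hx isT; rewrite big_seq1 /functional (bigD1 x) //=.
rewrite big1 => [|y yx]; rewrite coord_bvec_same ?eqxx ?mulr1 ?addr0 //.
by rewrite (negbTE yx) mulr0.
Qed.

End Dual.
End Eigenvectors.

(** * Coefficients of iterated coproducts *)

Section TensorPowers.
Variables (k : fieldType) (H : graded_hopf k).

Lemma tmap_linear (U U' V V' : lmodType k) (f : U -> U') (g : V -> V') :
  linear f -> linear g -> linear (tmap f g).
Proof. by move=> fl gl; exact: (tlift_linear (tmap_bilinear fl gl)). Qed.

Lemma tmap_sum (U U' V V' : lmodType k) (f : U -> U') (g : V -> V') :
  linear f -> linear g ->
  forall (I : Type) (r : seq I) (F : I -> U) (G : I -> V),
  tmap f g (\sum_(i <- r) F i ⊗ G i) = \sum_(i <- r) f (F i) ⊗ g (G i).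
Proof. by move=> fl gl I r F G; exact: (tlift_sum (tmap_bilinear fl gl)). Qed.

Lemma id_linear (U : lmodType k) : linear (@idfun U).
Proof. by []. Qed.

Lemma Delta_sum (x : H) : exists r : seq (H * H), Delta x = \sum_(p <- r) p.1 ⊗ p.2.
Proof. by exists (repr (Delta x)); exact: tensor_pureE. Qed.

Lemma Delta_last_linear a : linear (@Delta_last k H a).
Proof.
elim: a => [|a IHa]; first exact: linearP.
exact: (tmap_linear (@id_linear H) IHa).
Qed.

(** Each later coproduct acts on the last tensor factor, so the first factor is settled by the first
    coproduct; this allows recursion from the left. *)
Lemma iter_DeltaS a (x : H) (r : seq (H * H)) : Delta x = \sum_(p <- r) p.1 ⊗ p.2 ->
  iter_Delta a.+1 x = \sum_(p <- r) p.1 ⊗ iter_Delta a p.2.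
Proof.
move=> Dx; elim: a => [|a IHa] //=.
rewrite -[Delta_last _]/(iter_Delta a.+1 x) IHa.
exact: (tmap_sum (@id_linear H) (Delta_last_linear (a := a))).
Qed.

Lemma tpow_map_linear a (f : H -> H) : linear f -> linear (@tpow_map k H f a).
Proof. by move=> fl; elim: a => [//|a IHa]; exact: tmap_linear. Qed.

End TensorPowers.

Section WordCoef.
Variables (k : realFieldType) (H : graded_hopf k) (B : graded_basis H).

Lemma scalar_bilinear (U V : lmodType k) (f : U -> k^o) (g : V -> k^o) :
  linear f -> linear g -> bilinear_map (fun u v => f u * g v : k^o).
Proof.
move=> fl gl; split=> [v c u u'|u c v v'] /=.
  by rewrite fl mulrDl -mulrA.
by rewrite gl mulrDr mulrCA.
Qed.

Lemma tpow_coord_linear a (ws : seq (total_index B)) :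
  linear (@tpow_coord k H B a ws).
Proof.
elim: a ws => [|a IHa] [|w ws] /=; try by move=> c u v; rewrite ?linearP // scaler0 addr0.
by apply: tlift_linear; apply: scalar_bilinear; [exact: linearP|exact: IHa].
Qed.

(** The coefficient of a word in the iterated coproduct, written without tensor powers; ending with
    the counit gives the empty word a meaning. *)
Fixpoint word_coef (ws : seq (total_index B)) : H -> k^o :=
  if ws is w :: ws' then
    fun x => tlift (fun u v => tcoord w u * word_coef ws' v : k^o) (Delta x)
  else fun x => counit x.

Lemma word_coef_linear ws : linear (word_coef ws).
Proof.
elim: ws => [|w ws IH] c u v /=; rewrite linearP //.
by rewrite (tlift_linear (scalar_bilinear (linearP (tcoord w)) IH)).
Qed.

Lemma word_coef_cons w ws (x : H) (I : Type) (r : seq I) (F G : I -> H) :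
  Delta x = \sum_(p <- r) F p ⊗ G p ->
  word_coef (w :: ws) x = \sum_(p <- r) tcoord w (F p) * word_coef ws (G p).
Proof.
move=> Dx; rewrite /= Dx.
exact: (tlift_sum (scalar_bilinear (linearP (tcoord w)) (word_coef_linear ws))).
Qed.

Lemma word_coef1 w (h : H) : word_coef [:: w] h = tcoord w h.
Proof.
have [r Dx] := Delta_sum h; rewrite (word_coef_cons _ _ Dx) /=.
have cbr : bilinear_map (fun u v : H => counit v *: u).
  split=> [v c u u'|u c v v'] /=; first by rewrite scalerDr !scalerA mulrC.
  by rewrite linearP scalerDl scalerA.
rewrite -[in RHS](counitr h) Dx (tlift_sum cbr) linear_sum.
by apply: eq_bigr => p _; rewrite linearZ /= mulrC.
Qed.

Lemma tcoord_homog w n (v : H) : homog n v -> tag w != n -> tcoord (B := B) w v = 0.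
Proof. exact: coord_homog. Qed.

Lemma tcoord_Proj w n (v : H) :
  tcoord (B := B) w (Proj H n v) = if tag w == n then tcoord w v else 0.
Proof.
have hP i : homog i (Proj H i v) by rewrite /homog ProjK eqxx.
case: ifPn => [/eqP <-|wn]; last exact: tcoord_homog (hP n) wn.
have [N vN] := Proj_sum v; rewrite vN !linear_sum.
apply: eq_bigr => i _; rewrite ProjK; case: eqP => // /eqP wi.
by rewrite linear0 (tcoord_homog (hP i) wi).
Qed.

Lemma tpow_coordE a (ws : seq (total_index B)) (x : H) : size ws = a.+1 ->
  tpow_coord ws (tpow_map (Proj H 1%N) (iter_Delta a x)) =
  if all (fun w => tag w == 1%N) ws then word_coef ws x else 0.
Proof.
elim: a ws x => [|a IHa] [|w ws] //= x [sw].
  by rewrite (size0nil sw) andbT tcoord_Proj -word_coef1.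
have [r Dx] := Delta_sum x.
rewrite -[Delta_last _]/(iter_Delta a.+1 x) (iter_DeltaS a Dx).
rewrite (tmap_sum (linearP (Proj H 1%N)) (tpow_map_linear (linearP _))).
rewrite (tlift_sum (scalar_bilinear (linearP (tcoord w)) (tpow_coord_linear ws))).
rewrite -[tlift _ _]/(word_coef (w :: ws) x) (word_coef_cons _ _ Dx).
rewrite (eq_bigr (fun p => (if tag w == 1%N then tcoord w p.1 else 0) *
  (if all (fun w => tag w == 1%N) ws then word_coef ws p.2 else 0))); last first.
  by move=> p _; rewrite IHa // tcoord_Proj.
case: (tag w == 1%N) => /=; last by rewrite big1 // => p _; rewrite mul0r.
by case: (all _ ws) => //; rewrite big1 // => p _; rewrite mulr0.
Qed.

(** * Positivity of [eta] *)

Implicit Types (w x z : total_index B) (ws : seq (total_index B)).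

(** The basis elements of degree below [N]: a finite type, over which expansions in the whole basis
    become finite sums. *)
Definition bounded_index N := {j : 'I_N & B j}.

Definition unbound N (q : bounded_index N) : total_index B :=
  existT (basis_index B) (val (tag q)) (tagged q).

Definition bound N (w : total_index B) (wN : (tag w < N)%N) : bounded_index N :=
  existT (fun j : 'I_N => B j) (Ordinal wN) (tagged w).

Lemma bvec_expand N i (v : H) : homog i v -> (i < N)%N ->
  v = \sum_(q : bounded_index N) tcoord (unbound q) v *: tvec (unbound q).
Proof.
move=> hv iN.
rewrite -[RHS](sig_big_dep (fun _ => true) (fun _ _ => true)
  (fun (j : 'I_N) (x : B j) => Defs.coord x v *: bvec x)) /=.
rewrite (bigD1 (Ordinal iN)) //= -(bvec_span B hv) big1 ?addr0 // => j ji.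
rewrite big1 // => x _; rewrite (coord_homog _ hv) ?scale0r //.
Qed.

Lemma tcoord_tvec (w z : total_index B) : tcoord w (tvec z) = (w == z)%:R.
Proof. by case: w z => [i w] [j z]; exact: coord_bvec. Qed.

Lemma coord2_sum w z (I : Type) (r : seq I) (F G : I -> H) :
  coord2 (B := B) w z (\sum_(p <- r) F p ⊗ G p) =
  \sum_(p <- r) tcoord w (F p) * tcoord z (G p).
Proof. exact: (tlift_sum (scalar_bilinear (linearP _) (linearP _))). Qed.

Lemma coord2_linear w z : linear (coord2 (B := B) w z).
Proof. exact: (tlift_linear (scalar_bilinear (linearP _) (linearP _))). Qed.

Lemma Delta_graded (x : total_index B) : exists r : seq (H * H),
  Delta (tvec x) = \sum_(p <- r) p.1 ⊗ p.2 /\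
  forall p, p \in r -> exists i j, [/\ (i + j)%N = tag x, homog i p.1 & homog j p.2].
Proof. exact: graded_Delta (bvec_homog (tagged x)). Qed.

Lemma coord2_degree x w z : coord2 (B := B) w z (Delta (tvec x)) != 0 ->
  (tag w + tag z)%N = tag x.
Proof.
have [r [-> hr]] := Delta_graded x; rewrite coord2_sum.
apply: contraNeq => wz; rewrite big_seq big1 // => p /hr[i [j [ij hi hj]]].
have [wi|wi] := eqVneq (tag w) i; last by rewrite (tcoord_homog hi wi) mul0r.
rewrite [X in _ * X](tcoord_homog hj) ?mulr0 //.
by apply: contraNneq wz => zj; rewrite wi zj ij.
Qed.

Lemma Delta_right_sum x (f g : H -> k) : linear (f : H -> k^o) -> linear (g : H -> k^o) ->
  tlift (fun u v => f u * g v : k^o) (Delta (tvec x)) =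
  \sum_(q : bounded_index (tag x).+1)
    tlift (fun u v => f u * tcoord (unbound q) v : k^o) (Delta (tvec x)) *
    g (tvec (unbound q)).
Proof.
move=> fl gl; have [r [-> hr]] := Delta_graded x.
rewrite (tlift_sum (scalar_bilinear fl gl)).
under [RHS]eq_bigr => q _ do
  rewrite (tlift_sum (scalar_bilinear fl (linearP (tcoord (unbound q))))) mulr_suml.
rewrite exchange_big /= big_seq [RHS]big_seq.
apply: eq_bigr => p /hr[i [j [ij hi hj]]].
have jx : (j < (tag x).+1)%N by rewrite -ij ltnS leq_addl.
rewrite {1}(bvec_expand hj jx) (linear_fun_sum gl) mulr_sumr.
by apply: eq_bigr => q _; rewrite (linear_funZ gl) mulrA.
Qed.

Lemma Delta_left_sum x (f g : H -> k) : linear (f : H -> k^o) -> linear (g : H -> k^o) ->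
  tlift (fun u v => f u * g v : k^o) (Delta (tvec x)) =
  \sum_(q : bounded_index (tag x).+1)
    tlift (fun u v => tcoord (unbound q) u * g v : k^o) (Delta (tvec x)) *
    f (tvec (unbound q)).
Proof.
move=> fl gl; have [r [-> hr]] := Delta_graded x.
rewrite (tlift_sum (scalar_bilinear fl gl)).
under [RHS]eq_bigr => q _ do
  rewrite (tlift_sum (scalar_bilinear (linearP (tcoord (unbound q))) gl)) mulr_suml.
rewrite exchange_big /= big_seq [RHS]big_seq.
apply: eq_bigr => p /hr[i [j [ij hi hj]]].
have ix : (i < (tag x).+1)%N by rewrite -ij ltnS leq_addr.
rewrite {1}(bvec_expand hi ix) (linear_fun_sum fl) mulr_suml.
by apply: eq_bigr => q _; rewrite (linear_funZ fl) mulrAC.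
Qed.

(** Both sides are the coefficient of [w ⊗ w' ⊗ z] in the twofold coproduct of [x]. *)
Lemma coassoc_coord2 x w w' z :
  \sum_(q : bounded_index (tag x).+1)
    coord2 (unbound q) z (Delta (tvec x)) * coord2 w w' (Delta (tvec (unbound q))) =
  \sum_(q : bounded_index (tag x).+1)
    coord2 w (unbound q) (Delta (tvec x)) * coord2 w' z (Delta (tvec (unbound q))).
Proof.
have c2l u v : linear ((fun y => coord2 (B := B) u v (Delta y)) : H -> k^o).
  by move=> c y y'; rewrite linearP coord2_linear.
rewrite -(@Delta_right_sum x (tcoord w) (fun y => coord2 w' z (Delta y)));
  [|exact: linearP|exact: c2l].
rewrite -(@Delta_left_sum x (fun y => coord2 w w' (Delta y)) (tcoord z));
  [|exact: c2l|exact: linearP].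
have lam := scalar_bilinear (linearP (tcoord w)) (coord2_linear w' z).
have [r Dx] := Delta_sum (tvec x).
have := congr1 (tlift (fun u t => tcoord w u * coord2 w' z t : k^o)) (coassoc (tvec x)).
rewrite Dx (tmap_sum (@id_linear _ H) (linearP _)) (tlift_sum lam).
rewrite (tmap_sum (linearP _) (@id_linear _ H)).
rewrite (tlift_sum (scalar_bilinear (c2l w w') (linearP (tcoord z)))).
rewrite (tlift_sum (scalar_bilinear (linearP (tcoord w)) (c2l w' z))).
move=> <-; rewrite /tassoc.
have inner (v : H) : bilinear_map (fun u u' : H => u ⊗ (u' ⊗ v)).
  split=> [u c y y'|u c y y'] /=; first by rewrite pureDl pureZl.
  by rewrite pureDl pureZl pureDr pureZr.
have outer : bilinear_map (fun (t : tensor H H) (v : H) => tlift (fun u u' => u ⊗ (u' ⊗ v)) t).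
  split=> [v c t t'|t c v v'] /=; first exact: (tlift_linear (inner v)).
  rewrite [t]tensor_pureE !(tlift_sum (inner _)) scaler_sumr -big_split.
  by apply: eq_bigr => p _ /=; rewrite !pureDr !pureZr.
rewrite (tlift_sum outer) (linear_fun_sum (tlift_linear lam)).
apply: eq_bigr => p _; have [s ->] := Delta_sum p.1.
rewrite (tlift_sum (inner _)) (tlift_sum lam) coord2_sum mulr_suml.
apply: eq_bigr => q _; rewrite -mulrA; congr (_ * _).
by rewrite /coord2 tlift_pure //; exact: scalar_bilinear (linearP _) (linearP _).
Qed.

Hypothesis H_connected : connected H.
Hypothesis B_state : state_space_basis B.

Lemma coord2_ge0 x w z : 0 <= coord2 (B := B) w z (Delta (tvec x)).
Proof. by have [_ + _] := B_state; apply. Qed.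

Lemma word_coef_tvec w ws x : word_coef (w :: ws) (tvec x) =
  \sum_(q : bounded_index (tag x).+1)
    coord2 w (unbound q) (Delta (tvec x)) * word_coef ws (tvec (unbound q)).
Proof. by rewrite /= Delta_right_sum //; [exact: linearP|exact: word_coef_linear]. Qed.

Lemma tvec_neq0 x : tvec (B := B) x != 0.
Proof.
apply: contra_eqN (tcoord_tvec x x) => /eqP ->.
by rewrite linear0 eqxx eq_sym oner_neq0.
Qed.

Lemma word_coef_ge0 ws x : 0 <= word_coef ws (tvec x).
Proof.
elim: ws x => [|w ws IH] x; last first.
  rewrite word_coef_tvec; apply: sumr_ge0 => q _.
  by rewrite mulr_ge0 ?coord2_ge0.
have hx := bvec_homog (tagged x).
have [x0|x0] := eqVneq (tag x) 0%N; last by rewrite /= (graded_counit hx x0).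
have [|c xc] := homog0_scalar H_connected (x := tvec x); first by rewrite -x0.
have cx : counit (tvec x) = c by rewrite xc linearZ /= counit1; exact: mulr1.
(* In degree 0 the basis element is [c] times the unit, so [c] is a coefficient of its square and is
   non-negative. *)
have [/(_ x x x) + _ _] := B_state.
have -> : tcoord x (tvec x * tvec x) = c; last by rewrite /= cx.
by rewrite {1}xc -scalerAl mul1r linearZ /= tcoord_tvec eqxx; exact: mulr1.
Qed.

Lemma tensor_expand N (I : eqType) (r : seq I) (F G : I -> H) :
    (forall p, p \in r -> exists i j, [/\ (i < N)%N, (j < N)%N, homog i (F p) & homog j (G p)]) ->
  \sum_(p <- r) F p ⊗ G p =
  \sum_(q : bounded_index N) \sum_(q' : bounded_index N)
    coord2 (unbound q) (unbound q') (\sum_(p <- r) F p ⊗ G p) *: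
    (tvec (unbound q) ⊗ tvec (unbound q')).
Proof.
move=> hr.
under [RHS]eq_bigr => q _ do under eq_bigr => q' _ do rewrite coord2_sum scaler_suml.
under [RHS]eq_bigr => q _ do rewrite exchange_big /=.
rewrite exchange_big /= big_seq [RHS]big_seq.
apply: eq_bigr => p /hr[i [j [iN jN hi hj]]].
rewrite {1}(bvec_expand hi iN) (linear_fun_sum ((pure_bilinear H H).1 _)).
apply: eq_bigr => q _; rewrite {1}(bvec_expand hj jN).
rewrite (linear_fun_sum ((pure_bilinear H H).2 _)).
by apply: eq_bigr => q' _; rewrite pureZl pureZr scalerA.
Qed.

(** Coefficients are non-negative, so if none with both degrees positive were positive, the reduced
    coproduct would vanish and [x] would be primitive. *)
Lemma nonprimitive_coord2 x : (1 < tag x)%N ->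
  exists w z, [/\ (0 < tag w)%N, (0 < tag z)%N & 0 < coord2 (B := B) w z (Delta (tvec x))].
Proof.
move=> x1; have x0 := ltnW x1; have hx := bvec_homog (tagged x).
have [_ _ /(_ _ (tagged x) x1) nprim] := B_state.
have [//|no] := pselect (exists w z,
  [/\ (0 < tag w)%N, (0 < tag z)%N & 0 < coord2 (B := B) w z (Delta (tvec x))]).
have [s [Dx hs]] := Delta_pos H_connected hx x0.
case: nprim; rewrite Dx [X in _ + X = _](_ : _ = 0) ?addr0 1?addrC //.
rewrite (@tensor_expand (tag x).+1) => [|p /hs[/andP[_ /eqP h1] /andP[_ /eqP h2] px]].
  rewrite big1 // => q _; rewrite big1 // => q' _.
  apply/eqP; rewrite scaler_eq0; apply/orP; left.
  rewrite coord2_sum.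
  (* Coefficients with an index of degree 0 vanish because the terms of [s] have positive degrees.
     The others equal those of the full coproduct, to which [x ⊗ 1] and [1 ⊗ x] contribute
     nothing. *)
  have [q0|q0] := posnP (tag (unbound q)).
    rewrite big_seq big1 // => p /hs[/andP[p0 /eqP h1] _ _].
    by rewrite (tcoord_homog h1) ?mul0r // q0 ltn_eqF.
  have [q0'|q0'] := posnP (tag (unbound q')).
    rewrite big_seq big1 // => p /hs[_ /andP[p0 /eqP h2] _].
    by rewrite [X in _ * X](tcoord_homog h2) ?mulr0 // q0' ltn_eqF.
  rewrite -coord2_sum.
  have -> : \sum_(p <- s) p.1.2 ⊗ p.2.2 =
      Delta (tvec x) - (tvec x ⊗ 1 + 1 ⊗ tvec x) by rewrite Dx addrC addKr.
  have cl := coord2_linear (unbound q) (unbound q').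
  rewrite -scaleN1r addrC cl scaleN1r !(linear_funD cl).
  have one0 w : (0 < tag w)%N -> tcoord (B := B) w 1 = 0.
    by move=> w0; rewrite (tcoord_homog (graded1 H)) // -lt0n.
  have c2p u v : coord2 (unbound q) (unbound q') (u ⊗ v) =
      tcoord (unbound q) u * tcoord (unbound q') v.
    by rewrite /coord2 tlift_pure //; exact: scalar_bilinear (linearP _) (linearP _).
  rewrite !c2p !one0 // mulr0 mul0r addr0 oppr0 add0r.
  rewrite eq_le coord2_ge0 andbT leNgt; apply/negP => qq'.
  by apply: no; exists (unbound q), (unbound q').
exists p.1.1, p.2.1; rewrite !ltnS -px leq_addr leq_addl; split=> //.
Qed.

(** If [w ⊗ z] occurs in the coproduct of [x], induction finds [d ⊗ w'] in that of [w] with [d] of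
    degree 1. Then [d ⊗ w' ⊗ z] occurs without cancellation, and coassociativity yields a term of
    the coproduct of [x] with left factor [d]. *)
Lemma coord2_degree1 x : (1 < tag x)%N ->
  exists w z, tag w = 1%N /\ 0 < coord2 (B := B) w z (Delta (tvec x)).
Proof.
have [m] := ubnP (tag x); elim: m x => [//|m IHm] x; rewrite ltnS => xm x1.
have [w [z [w0 z0 wz]]] := nonprimitive_coord2 x1.
have dx := coord2_degree (lt0r_neq0 wz).
have [w1|w1] := eqVneq (tag w) 1%N; first by exists w, z.
have [||d [w' [d1 dw']]] := IHm w.
- by apply: leq_trans xm; rewrite -dx -addn1 leq_add2l.
- by rewrite ltn_neqAle eq_sym w1.
have wx : (tag w < (tag x).+1)%N by rewrite ltnS -dx leq_addr.
have ub : unbound (bound wx) = w by case: w {w0 wz dx w1 dw'} wx.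
have pos : 0 < \sum_(q : bounded_index (tag x).+1)
    coord2 (unbound q) z (Delta (tvec x)) * coord2 d w' (Delta (tvec (unbound q))).
  rewrite (bigD1 (bound wx)) //= ltr_pwDl ?ub ?mulr_gt0 //.
  by apply: sumr_ge0 => q _; rewrite mulr_ge0 ?coord2_ge0.
have [q dq] : exists q : bounded_index (tag x).+1,
    coord2 d (unbound q) (Delta (tvec x)) != 0.
  apply/existsP; apply: contraLR pos; rewrite coassoc_coord2 negb_exists.
  move=> /forallP q0; rewrite big1 ?ltxx // => q _.
  by have := q0 q; rewrite negbK => /eqP ->; rewrite mul0r.
by exists d, (unbound q); rewrite lt_def dq coord2_ge0.
Qed.

Lemma word_coef_gt0 x : exists ws,
  [/\ size ws = tag x, all (fun w => tag w == 1%N) ws & 0 < word_coef ws (tvec x)].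
Proof.
have [m] := ubnP (tag x); elim: m x => [//|m IHm] x; rewrite ltnS => xm.
case: (ltngtP (tag x) 1%N) => [x0|x1|x1].
- have {}x0 : tag x = 0%N by case: (tag x) x0.
  exists [::]; rewrite x0 lt_def word_coef_ge0 andbT; split=> //=.
  have hx := bvec_homog (tagged x).
  have [|c xc] := homog0_scalar H_connected (x := tvec x); first by rewrite -x0.
  apply: contraNneq (tvec_neq0 x) => cx.
  move: cx; rewrite xc linearZ /= counit1 => /(etrans (esym (mulr1 c))) ->.
  by rewrite scale0r.
- have [d [y [d1 dy]]] := coord2_degree1 x1.
  have dx := coord2_degree (lt0r_neq0 dy).
  have [|ws [sws ws1 ws0]] := IHm y.
    by apply: leq_trans xm; rewrite -dx d1 add1n.
  exists (d :: ws); rewrite /= sws -dx d1 eqxx ws1; split=> //.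
  rewrite -[tlift _ _]/(word_coef (d :: ws) (tvec x)) word_coef_tvec.
  have yx : (tag y < (tag x).+1)%N by rewrite ltnS -dx leq_addl.
  have ub : unbound (bound yx) = y by case: y {dy dx sws ws0} yx.
  rewrite (bigD1 (bound yx)) //= ltr_pwDl ?ub ?mulr_gt0 //.
  by apply: sumr_ge0 => q _; rewrite mulr_ge0 ?coord2_ge0 ?word_coef_ge0.
by exists [:: x]; rewrite word_coef1 tcoord_tvec eqxx ltr01 /= x1.
Qed.

Definition letter (b : B 1%N) : total_index B := existT (basis_index B) 1%N b.

Lemma letter_inj : injective letter.
Proof. by move=> b b' /eqP; rewrite eq_Tagged => /eqP. Qed.

Lemma degree1_word ws : all (fun w : total_index B => tag w == 1%N) ws ->
  exists cs : seq (B 1%N), ws = [seq letter b | b <- cs].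
Proof.
elim: ws => [|[i w] ws IH] /=; first by exists [::].
case/andP=> /eqP i1 /IH[cs ->]; subst i.
by exists (w :: cs).
Qed.

Lemma eta_gt0 n (x : B n) : (0 < n)%N -> 0 < eta x.
Proof.
move=> n0; pose f (ws : n.-tuple (total_index B)) : k :=
  tpow_coord ws (tpow_map (Proj H 1%N) (iter_Delta n.-1 (bvec x))).
have fE (ws : n.-tuple (total_index B)) : f ws =
    if all (fun w => tag w == 1%N) ws then word_coef ws (bvec x) else 0.
  by apply: tpow_coordE; rewrite size_tuple prednK.
have f_ge0 (ws : n.-tuple (total_index B)) : 0 <= f ws.
  by rewrite fE; case: ifP => // _; exact: (word_coef_ge0 ws (existT (basis_index B) n x)).
(* The words in degree one letters form a finite list that contains the support of the sum defining
   [eta]. *)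
pose r : seq (n.-tuple (total_index B)) :=
  [seq map_tuple letter c | c <- enum {: n.-tuple (B 1%N)}].
have r_all (ws : n.-tuple (total_index B)) : all (fun w => tag w == 1%N) ws -> ws \in r.
  move=> /degree1_word[cs wcs].
  have sc : size cs == n by rewrite -(size_tuple ws) wcs size_map.
  apply/mapP; exists (Tuple sc); rewrite ?mem_enum //.
  by apply: val_inj.
have r_uniq : uniq r.
  rewrite map_inj_uniq ?enum_uniq // => c c' /(congr1 val) /= cc'; apply: val_inj.
  exact: inj_map letter_inj _ _ cc'.
have -> : eta x = \sum_(ws <- r) f ws.
  rewrite /eta fsbig_supp (fsbig_fwiden r) //.
    move=> ws /= [_ /eqP]; rewrite -/(f ws) fE; case: ifP => [/r_all//|_].
    by rewrite eqxx.
  move=> ws /= [_ nws]; apply: contrapT => fws; apply: nws; split=> //.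
have [ws [sws ws1 ws0]] := word_coef_gt0 (existT (basis_index B) n x).
have sw : size ws == n by apply/eqP.
rewrite lt_def sumr_ge0 ?andbT // psumr_eq0 //.
apply/allPn; exists (Tuple sw); first exact: r_all.
by rewrite fE /= ws1 gt_eqF.
Qed.

End WordCoef.

(** * Independence of the symmetrised products *)

Section Matches.
Variable T : eqType.
Implicit Types ds cs : seq T.

(* The number of ways of matching the letters of [ds] with equal letters of
   [cs] bijectively. *)
Fixpoint matches ds cs : nat :=
  if ds is d :: ds' then
    (\sum_(p <- unshuffle cs) (p.1 == [:: d]) * matches ds' p.2)%N
  else cs == [::].

Lemma unshuffle_nill cs : ([::], cs) \in unshuffle cs.
Proof.
elim: cs => [|i cs IH] //=; rewrite mem_cat; apply/orP; right.
exact: (map_f (fun p => (p.1, i :: p.2)) IH).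
Qed.

Lemma unshuffle_rem d cs : d \in cs -> ([:: d], rem d cs) \in unshuffle cs.
Proof.
elim: cs => [//|i cs IH] /=; rewrite inE eq_sym mem_cat.
have [->|id] := eqVneq i d => /= [_|/IH dcs]; apply/orP.
  left; exact: (map_f (fun p => (d :: p.1, p.2)) (unshuffle_nill cs)).
right; exact: (map_f (fun p => (p.1, i :: p.2)) dcs).
Qed.

Lemma matches_gt0 ds cs : (0 < matches ds cs)%N = perm_eq ds cs.
Proof.
elim: ds cs => [|d ds IH] cs /=.
  case: cs => [|b cs] //=; by apply/esym/negbTE/negP => /perm_size.
apply/idP/idP => [|dcs].
  rewrite lt0n sum_nat_seq_eq0 => /allPn[p pcs].
  rewrite implyTb muln_eq0 negb_or eqb0 negbK -lt0n IH => /andP[/eqP p1 p2].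
  apply: perm_trans (unshuffle_perm pcs); rewrite p1 /= perm_cons.
  by [].
have din : d \in cs by rewrite -(perm_mem dcs) mem_head.
have := unshuffle_rem din; case/splitPr => s1 s2.
rewrite big_cat big_cons /= eqxx mul1n addnCA ltn_addr // IH.
by rewrite -(perm_cons d) (perm_trans dcs) // perm_to_rem.
Qed.

End Matches.

Section Multisets.
Variables (n : nat) (T : finType).

Let le_rank (x y : T) := (enum_rank x <= enum_rank y)%N.

Lemma multiset_rep (c : n.-tuple T) : exists m : multiset n T, perm_eq (val m) c.
Proof.
have le_total : total le_rank by move=> x y; exact: leq_total.
have sP : sorted le_rank (sort_tuple le_rank c) by exact: sort_sorted.
by exists (exist _ (sort_tuple le_rank c) sP); rewrite /= perm_sort.
Qed.

Lemma multiset_inj (m m' : multiset n T) : perm_eq (val m) (val m') -> m = m'.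
Proof.
move=> mm'; apply: val_inj; apply: val_inj.
apply: (sorted_eq (leT := le_rank) _ _ (valP m) (valP m') mm').
  by move=> y x z; exact: leq_trans.
by move=> x y /anti_leq /val_inj /enum_rank_inj.
Qed.

End Multisets.

Section Independence.
Variables (k : realFieldType) (H : graded_hopf k).
Hypothesis H_connected : connected H.
Variable B : graded_basis H.

(** A correction term in [Delta_eval] would have more factors than its total degree, so there is
    none. *)
Lemma Delta_ones (w : seq (nat * H)) : hword w -> all (fun y => y.1 == 1%N) w ->
  Delta (eval w) = \sum_(p <- unshuffle w) eval p.1 ⊗ eval p.2.
Proof.
move=> hw w1; have [s [-> hs]] := Delta_eval H_connected hw.
case: s hs => [|p s] hs; first by rewrite cats0.
have [p1 p2 pd] := hs p (mem_head _ _).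
have le u : hword u -> (size u <= deg u)%N.
  by move=> hu; apply: size_le_weight; apply: sub_all hu => y /andP[].
rewrite -[X in (X < _)%N](weight_size w1) -pd ltnNge.
by rewrite leq_add ?le.
Qed.

Lemma Delta_letters (cs : seq (B 1%N)) :
  Delta (\prod_(b <- cs) bvec b) =
  \sum_(p <- unshuffle cs) (\prod_(b <- p.1) bvec b) ⊗ (\prod_(b <- p.2) bvec b).
Proof.
pose h (b : B 1%N) : nat * H := (1%N, bvec b).
have := @Delta_ones (map h cs); rewrite big_map /= => ->.
- by rewrite unshuffle_map big_map; apply: eq_bigr => p _; rewrite !big_map.
- rewrite all_map; apply/allP => b _; rewrite /= /pos_homog /=.
  by apply/eqP; exact: bvec_homog.
- by rewrite all_map; apply/allP.
Qed.

Lemma prod_letters_homog (cs : seq (B 1%N)) :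
  homog (size cs) (\prod_(b <- cs) bvec b).
Proof.
elim: cs => [|b cs IH]; first by rewrite big_nil; exact: graded1.
by rewrite big_cons; apply: (gradedM (bvec_homog b) IH).
Qed.

Lemma word_coef_prod (ds cs : seq (B 1%N)) :
  word_coef (map (@letter _ _ _) ds) (\prod_(b <- cs) bvec b) = (matches ds cs)%:R.
Proof.
elim: ds cs => [|d ds IH] cs.
  case: cs => [|b cs] /=; first by rewrite big_nil counit1.
  by rewrite (graded_counit (prod_letters_homog (b :: cs))).
rewrite (word_coef_cons _ _ (Delta_letters cs)) natr_sum.
apply: eq_bigr => p _; rewrite IH natrM; congr (_ * _).
case: p.1 => [|b [|b' u]].
- by rewrite big_nil (tcoord_homog (graded1 H)).
- rewrite big_seq1 -[bvec b]/(tvec (letter b)) tcoord_tvec eq_sym.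
  by rewrite (inj_eq (@letter_inj _ _ _)) eqseq_cons andbT.
- rewrite (tcoord_homog (prod_letters_homog (b :: b' :: u))) //.
  by rewrite eqseq_cons andbF.
Qed.

Lemma symprod_perm n (c c' : n.-tuple (B 1%N)) : perm_eq c c' ->
  symprod c = symprod c'.
Proof.
move=> /tuple_permP[t ct]; rewrite /symprod [RHS](reindex_inj (mulIg t)) /=.
apply: eq_bigr => s _; apply: eq_bigr => i _; congr bvec.
have -> : c = [tuple tnth c' (t i) | i < n] by apply: val_inj.
by rewrite tnth_mktuple permM.
Qed.

Lemma word_coef_symprod n (ds c : n.-tuple (B 1%N)) :
  word_coef (map (@letter _ _ _) ds) (symprod c) =
  (\sum_(s : 'S_n) matches ds [seq tnth c (s i) | i <- enum 'I_n])%:R.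
Proof.
rewrite /symprod (linear_fun_sum (word_coef_linear _)) natr_sum.
apply: eq_bigr => s _; rewrite -word_coef_prod big_map.
by rewrite enumT [index_enum _]unlock.
Qed.

(** The coefficient of the word [c] kills the symmetrised products of all other multisets and is
    positive on that of [c], where the identity permutation already gives a matching. *)
Lemma symprod_free n (t : multiset n (B 1%N) -> k) :
  (forall x : B n, \sum_c t c * Defs.coord x (symprod (val c)) = 0) ->
  forall c, t c = 0.
Proof.
move=> t0 c.
have v0 : \sum_c t c *: symprod (val c) = 0.
  have hv : homog n (\sum_c t c *: symprod (val c)).
    rewrite /homog linear_sum; apply: eq_bigr => c' _.
    by rewrite linearZ /= symprod_homog.
  rewrite (bvec_span B hv) big1 // => x _.
  rewrite linear_sum (eq_bigr (fun c => t c * Defs.coord x (symprod (val c)))).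
    by rewrite t0 scale0r.
  by move=> c' _; rewrite linearZ.
have := congr1 (word_coef (map (@letter _ _ _) (val c))) v0.
have wl := word_coef_linear (map (@letter _ _ B) (val c)).
rewrite (linear_fun0 wl) (linear_fun_sum wl) (bigD1 c) //= big1 ?addr0.
  rewrite (linear_funZ wl) word_coef_symprod => /eqP; rewrite scaler_eq0.
  case/orP => [/eqP //|]; rewrite pnatr_eq0 sum_nat_eq0 => /forallP /(_ 1%g).
  rewrite implyTb -leqn0 leqNgt matches_gt0.
  rewrite (eq_map (g := tnth (val c))) => [|i]; last by rewrite perm1.
  by rewrite map_tnth_enum perm_refl.
move=> c' cc'; rewrite (linear_funZ wl) word_coef_symprod big1 ?scaler0 // => s _.
apply/eqP; rewrite -leqn0 leqNgt matches_gt0; apply: contra cc' => cs.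
apply/eqP/esym/multiset_inj; apply: perm_trans cs _.
rewrite -[X in perm_eq _ X](map_tnth_enum (val c')) map_comp; apply: perm_map.
exact: perm_enum_map.
Qed.

End Independence.

(** * The stationary eigenspace *)

Section Eigenspace.
Variables (k : realFieldType) (H : graded_hopf k).
Hypothesis H_connected : connected H.
Variables (B : graded_basis H) (n : nat).

Definition symprod_mx : 'M[k]_(#|{: multiset n (B 1%N)}|, #|B n|) :=
  \matrix_(c, x) Defs.coord (enum_val x) (symprod (val (enum_val c))).

Lemma sum_enum_val (V : nmodType) (T : finType) (F : T -> V) :
  \sum_(i < #|T|) F (enum_val i) = \sum_x F x.
Proof. by rewrite -(big_enum_val F). Qed.

Lemma symprod_mx_free : row_free symprod_mx.
Proof.
rewrite -kermx_eq0; apply/rowV0P => v /sub_kermxP vS.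
have v0 := @symprod_free _ _ H_connected B n (fun c => v 0 (enum_rank c)).
apply/rowP => i; rewrite mxE -[i]enum_valK v0 // => x.
have /matrixP/(_ 0 (enum_rank x)) := vS; rewrite !mxE => vS0; apply: etrans vS0.
rewrite -[LHS]sum_enum_val; apply: eq_bigr => j _.
by rewrite mxE enum_valK enum_rankK.
Qed.

Section Psi.
Variables (a : nat) (alpha : a.-tuple 'I_n.+1 -> k).
Hypothesis alpha_nonneg : nonneg_convolution alpha.

(** In degree 0 every part of a weak composition equals [n], against the nontriviality condition. *)
Lemma degree_gt0 : (0 < n)%N.
Proof.
have [a2 _ [D [_ _ nD]]] := alpha_nonneg; rewrite lt0n; apply/eqP => n0.
have := nD (Ordinal (ltnW a2)); case: (tnth _ _) => m /= mn.
by apply/negP; rewrite negbK; apply/eqP; lia.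
Qed.

Definition Psi_mx : 'M[k]_#|B n| :=
  \matrix_(x, y) Defs.coord (enum_val y) (Psi alpha (bvec (enum_val x))).

(* The left and right eigenspaces have the same dimension, and a right
   eigenvector orthogonal to the symmetrised products vanishes. *)
Lemma Psi_eigenspace : (kermx (Psi_mx - (beta alpha)%:M) :=: symprod_mx)%MS.
Proof.
set M := _ - _; apply/eqmxP; rewrite andbC.
have SM : (symprod_mx <= kermx M)%MS.
  apply/sub_kermxP; apply/matrixP => c y; rewrite mulmxBr mul_mx_scalar !mxE.
  apply/eqP; rewrite subr_eq0; apply/eqP.
  rewrite -(symprod_eigen H_connected alpha_nonneg).
  rewrite [in RHS](bvec_span B (symprod_homog _)).
  rewrite (linear_fun_sum (Psi_linear alpha_nonneg)) linear_sum -[RHS]sum_enum_val.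
  apply: eq_bigr => x _; rewrite !mxE.
  by rewrite (linear_funZ (Psi_linear alpha_nonneg)) linearZ.
rewrite SM /= -(geq_leqif (mxrank_leqif_sup SM)) mxrank_ker.
rewrite -(mxrank_tr M) -mxrank_ker.
(* It remains to bound the dimension of the kernel of the transpose. Pairing with the symmetrised
   products is injective on it, so this dimension is at most the rank of [symprod_mx]. *)
have dual : (kermx M^T :&: kermx symprod_mx^T)%MS = 0.
  apply/eqP/rowV0P => v.
  rewrite sub_capmx => /andP[/sub_kermxP vM /sub_kermxP vS].
  apply/rowP => x; rewrite mxE -[x]enum_valK.
  apply: (functional_eq0 H_connected alpha_nonneg (f := fun x => v 0 (enum_rank x)))
    => [{}x|c|].
  - have /matrixP/(_ 0 (enum_rank x)) := vM.
    rewrite linearB /= tr_scalar_mx mulmxBr mul_mx_scalar !mxE => /eqP.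
    rewrite subr_eq0 => /eqP <-; rewrite -[LHS]sum_enum_val.
    by apply: eq_bigr => y _; rewrite !mxE enum_valK enum_rankK mulrC.
  - have [m mc] := multiset_rep c.
    have /matrixP/(_ 0 (enum_rank m)) := vS; rewrite !mxE => vS0; apply: etrans vS0.
    rewrite -[LHS]sum_enum_val; apply: eq_bigr => y _.
    by rewrite !mxE enum_valK enum_rankK (symprod_perm mc).
  - exact: degree_gt0.
have := mxrank_mul_ker (kermx M^T) symprod_mx^T; rewrite dual mxrank0 addn0 => <-.
by rewrite (leq_trans (mxrankM_maxr _ _)) // mxrank_tr.
Qed.

(** * Stationary distributions with real values *)

Variables (R : realType) (iota : {rmorphism k -> R}).
Hypothesis B_state : state_space_basis B.

(** Undoes the rescaling by [eta] in [transition], so that invariance becomes an eigenvector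
    equation for [Psi_mx]. *)
Definition density (p : B n -> R) : 'rV[R]_#|B n| :=
  \row_x (p (enum_val x) / iota (eta (enum_val x))).

Lemma iota_eta_neq0 (x : B n) : iota (eta x) != 0.
Proof.
by rewrite fmorph_eq0 gt_eqF // (eta_gt0 H_connected B_state x degree_gt0).
Qed.

Lemma invariant_symprod (p : B n -> R) :
  (forall y, \sum_x p x * iota (transition alpha x y) = p y) <->
  (density p <= map_mx iota symprod_mx)%MS.
Proof.
have b0 : iota (beta alpha) != 0 by rewrite fmorph_eq0 gt_eqF ?beta_gt0.
have E y : \sum_x p x * iota (transition alpha x y) =
    iota (eta y) / iota (beta alpha) *
    (density p *m map_mx iota Psi_mx) 0 (enum_rank y).
  rewrite mxE mulr_sumr -[LHS]sum_enum_val; apply: eq_bigr => i _.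
  rewrite !mxE enum_rankK /transition !rmorphM fmorphV rmorphM.
  by field; rewrite b0 iota_eta_neq0.
(* The eigenspace is known over [k]; kernels and inclusions of row spaces are compatible with the
   field extension [iota]. *)
have -> : (density p <= map_mx iota symprod_mx)%MS =
    (density p *m map_mx iota Psi_mx == iota (beta alpha) *: density p).
  rewrite -subr_eq0 -mul_mx_scalar -mulmxBr -map_scalar_mx -map_mxB.
  rewrite -[RHS](sameP sub_kermxP eqP) -map_kermx.
  by apply/idP/idP => /submx_trans; apply; rewrite map_submx Psi_eigenspace.
split=> [inv|/eqP/rowP inv y].
  apply/eqP/rowP => i; have := inv (enum_val i); rewrite E enum_valK !mxE.
  move=> <-; field.
  by rewrite b0 iota_eta_neq0.
rewrite E inv !mxE enum_rankK.
by field; rewrite b0 iota_eta_neq0.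
Qed.

Lemma pi_funE c (x : B n) : pi_fun c x = eta x / n`!%:R ^+ 2 * Defs.coord x (symprod c).
Proof. by rewrite /pi_fun linear_sum. Qed.

(** The factor [1/n!^2] of [pi_fun] is moved into the coefficients. *)
Definition weights (t : multiset n (B 1%N) -> R) : 'rV[R]_#|{: multiset n (B 1%N)}| :=
  \row_c (t (enum_val c) / iota n`!%:R ^+ 2).

Lemma symprod_decomposition (p : B n -> R) (t : multiset n (B 1%N) -> R) :
  (forall x, p x = \sum_c t c * iota (pi_fun (val c) x)) <->
  density p = weights t *m map_mx iota symprod_mx.
Proof.
have E x : \sum_c t c * iota (pi_fun (val c) x) =
    iota (eta x) * (weights t *m map_mx iota symprod_mx) 0 (enum_rank x).
  rewrite mxE mulr_sumr -[LHS]sum_enum_val; apply: eq_bigr => c _.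
  by rewrite !mxE enum_rankK pi_funE !rmorphM fmorphV rmorphXn; ring.
split=> [pE|dE x].
  apply/rowP => x; rewrite mxE pE E enum_valK.
  by rewrite mulrAC mulfV ?mul1r ?iota_eta_neq0.
rewrite E -dE mxE enum_rankK.
by field; rewrite iota_eta_neq0.
Qed.

Lemma iota_fact_neq0 : iota n`!%:R ^+ 2 != 0.
Proof. by rewrite expf_neq0 // fmorph_eq0 pnatr_eq0 -lt0n fact_gt0. Qed.

Lemma symprod_decomposition_exists (p : B n -> R) :
    (density p <= map_mx iota symprod_mx)%MS ->
  exists! t : {ffun multiset n (B 1%N) -> R},
    forall x : B n, p x = \sum_c t c * iota (pi_fun (val c) x).
Proof.
case/submxP => D pD.
exists [ffun c => D 0 (enum_rank c) * iota n`!%:R ^+ 2]; split.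
  apply/symprod_decomposition; rewrite pD; congr (_ *m _); apply/rowP => c.
  by rewrite mxE ffunE enum_valK mulfK ?iota_fact_neq0.
move=> t /symprod_decomposition; rewrite pD.
(* Uniqueness: the rows of [symprod_mx] stay independent after extension to [R]. *)
move=> /(row_free_inj (_ : row_free (map_mx iota symprod_mx))) Dt.
apply/ffunP => c; rewrite ffunE Dt ?row_free_map ?symprod_mx_free //.
by rewrite mxE enum_rankK divfK ?iota_fact_neq0.
Qed.

End Psi.
End Eigenspace.

Theorem theorem4p5 (R : realType) (k : realFieldType)
    (iota : {rmorphism k -> R}) (iota_mono : {mono iota : x y / x <= y})
    (H : graded_hopf k) (H_connected : connected H)
    (B : graded_basis H) (B_state : state_space_basis B) (n : nat) :
  (forall (a a' : nat) (alpha : a.-tuple 'I_n.+1 -> k)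
          (alpha' : a'.-tuple 'I_n.+1 -> k),
     nonneg_convolution alpha -> nonneg_convolution alpha' ->
     forall p : B n -> R,
       stationary_distribution (fun x y => iota (transition alpha x y)) p <->
       stationary_distribution (fun x y => iota (transition alpha' x y)) p) /\
  (forall (a : nat) (alpha : a.-tuple 'I_n.+1 -> k),
     nonneg_convolution alpha ->
     forall p : B n -> R,
       stationary_distribution (fun x y => iota (transition alpha x y)) p ->
       exists! t : {ffun multiset n (B 1%N) -> R},
         forall x : B n, p x = \sum_c t c * iota (pi_fun (val c) x)).
Proof.
have inv a (alpha : a.-tuple 'I_n.+1 -> k) (ca : nonneg_convolution alpha) p :=
  invariant_symprod H_connected ca iota B_state p.
split=> [a a' alpha alpha' ca ca' p|a alpha ca p [_ _ /(inv _ _ ca) pS]].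
  (* The criterion in [inv] involves only the symmetrised products, so it is common to both
     chains. *)
  by split=> -[p0 p1 pK]; split=> //;
    [apply/(inv _ _ ca')/(inv _ _ ca)|apply/(inv _ _ ca)/(inv _ _ ca')].
exact: (symprod_decomposition_exists H_connected ca B_state).
Qed.
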